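(* Let $f(\theta)=1+\frac12\cos\theta+\frac18\cos(2\theta)$. For $T>0$, let $\sigma_1(f,f,T)$ be the first nonzero Steklov eigenvalue of $[0,T]\times\mathbb{S}^1$ with the metric $f(\theta)^2(dt^2+d\theta^2)$, and let $\sigma_1(1,T)$ be the first nonzero Steklov eigenvalue of $[0,T]\times\mathbb{S}^1$ with the metric $dt^2+d\theta^2$. When $T<T_{1,0}(1)$ is small enough (i.e. there is $T_*\in(0,T_{1,0}(1)]$ such that for all $0<T<T_*$), $$\sigma_1(f,f,T)>\lambda_1(1,T)=\sigma_1(1,T),$$ where $\lambda_1(1,T)=\tanh(T/2)$.
   Context: $\mathbb{S}^1=\mathbb{R}/2\pi\mathbb{Z}$. For a compact Riemannian surface $(M,g)$ with nonempty boundary, the Dirichlet-to-Neumann map sends $u\in C^\infty(\partial M)$ to $\partial\hat u/\partial n$, with $\hat u$ the harmonic extension and $n$ the unit outward normal; its eigenvalues $0=\sigma_0(g)<\sigma_1(g)\le\sigma_2(g)\le\cdots$ (with multiplicity) are the Steklov eigenvalues. $T_{1,0}(1)$ is the unique positive $T$ with $4\pi\tanh(T/2)=8\pi/T$. *)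

(* Defs.v *)
From Stdlib Require Import Reals.
From Coquelicot Require Import Coquelicot.
Open Scope R_scope.

(* The cylinder [0,T] x S^1 is handled in coordinates (t, theta), where
   theta ranges over R and every object is 2 PI-periodic in theta.
   "Smooth on the compact cylinder" means "restriction to 0 <= t <= T of a
   smooth function on R x S^1", the usual notion on a manifold with boundary. *)

Record metric := Metric {
  g_tt : R -> R -> R;
  g_th : R -> R -> R;   (* off-diagonal coefficient g(d/dt, d/dtheta) *)
  g_hh : R -> R -> R }.

Definition product_metric : metric :=
  Metric (fun _ _ => 1) (fun _ _ => 0) (fun _ _ => 1).

Definition warped_metric (f : R -> R) : metric :=
  Metric (fun _ h => f h ^ 2) (fun _ _ => 0) (fun _ h => f h ^ 2).

Definition det_g (g : metric) (t h : R) : R :=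
  g_tt g t h * g_hh g t h - g_th g t h ^ 2.

Definition D_t (U : R -> R -> R) (t h : R) : R := Derive (fun z => U z h) t.
Definition D_h (U : R -> R -> R) (t h : R) : R := Derive (fun z => U t z) h.

(* Coordinates of the g-gradient; the inverse of the matrix of g is
   (g_hh, - g_th; - g_th, g_tt) / det_g. *)
Definition grad_t (g : metric) (U : R -> R -> R) (t h : R) : R :=
  (g_hh g t h * D_t U t h - g_th g t h * D_h U t h) / det_g g t h.
Definition grad_h (g : metric) (U : R -> R -> R) (t h : R) : R :=
  (g_tt g t h * D_h U t h - g_th g t h * D_t U t h) / det_g g t h.

Definition laplace_beltrami (g : metric) (U : R -> R -> R) (t h : R) : R :=
  (D_t (fun t h => sqrt (det_g g t h) * grad_t g U t h) t h +
   D_h (fun t h => sqrt (det_g g t h) * grad_h g U t h) t h)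
  / sqrt (det_g g t h).

(* The boundary consists of two circles: [false] is t = 0, [true] is t = T. *)
Definition bd_fun := bool -> R -> R.

Definition bd_t (T : R) (i : bool) : R := if i then T else 0.

(* The unit outward normal is grad t / |grad t| at t = T and the opposite
   vector at t = 0; moreover <grad t, grad U> is the t-coordinate of grad U,
   and |grad t|^2 = g_hh / det_g. *)
Definition normal_derivative (g : metric) (T : R) (U : R -> R -> R) : bd_fun :=
  fun i h =>
    (if i then 1 else -1) * grad_t g U (bd_t T i) h
    / sqrt (g_hh g (bd_t T i) h / det_g g (bd_t T i) h).

Definition smooth_cylinder (U : R -> R -> R) : Prop :=
  (forall t h, U t (h + 2 * PI) = U t h) /\
  (forall n t h, ex_diff_n U n t h).

Definition smooth_boundary (u : bd_fun) : Prop :=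
  (forall i h, u i (h + 2 * PI) = u i h) /\
  (forall i n h, ex_derive_n (u i) n h).

Definition harmonic_extension (g : metric) (T : R) (u : bd_fun)
    (U : R -> R -> R) : Prop :=
  smooth_cylinder U /\
  (forall t h, 0 < t < T -> laplace_beltrami g U t h = 0) /\
  (forall i h, U (bd_t T i) h = u i h).

(* Graph of the Dirichlet-to-Neumann map. *)
Definition dirichlet_to_neumann (g : metric) (T : R) (u v : bd_fun) : Prop :=
  smooth_boundary u /\
  exists U, harmonic_extension g T u U /\
    forall i h, v i h = normal_derivative g T U i h.

Definition steklov_eigenvalue (g : metric) (T sigma : R) : Prop :=
  exists u : bd_fun,
    (exists i h, u i h <> 0) /\
    dirichlet_to_neumann g T u (fun i h => sigma * u i h).

Definition first_nonzero_steklov (g : metric) (T sigma : R) : Prop :=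
  steklov_eigenvalue g T sigma /\ sigma <> 0 /\
  forall sigma', steklov_eigenvalue g T sigma' -> sigma' <> 0 ->
    sigma <= sigma'.

(* [iota] is definite description: the unique T with the given property. *)
Definition T_10 : R :=
  iota (fun T : R => 0 < T /\ 4 * PI * tanh (T / 2) = 8 * PI / T).

Definition f_warp (h : R) : R := 1 + / 2 * cos h + / 8 * cos (2 * h).

(* Main.v *)
Require Import Defs.
From Stdlib Require Import Reals Lra.
From Coquelicot Require Import Coquelicot.
Open Scope R_scope.

(** Both metrics are conformal to the flat one, with factor [f ^ 2] (take
    [f = 1] for the flat cylinder).  Dirichlet energy is conformally invariant
    in dimension two, so a Steklov eigenfunction extends to a function [U]
    that is harmonic for the flat Laplacian and satisfies
    [dU/dn = sigma * f * U] on the two boundary circles: only the boundary mass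
    sees [f].

    Write [B] for the boundary integral of [f * U ^ 2].  By Green's formula
    [sigma * B] is the Dirichlet energy of [U].  On a short cylinder [U] hardly
    depends on [t], so the energy is about [T * int (w') ^ 2] and [B] about
    [2 * int f * w ^ 2], where [w] is a slice of [U] and [f * w] has mean nearly
    zero.  Hence [sigma] is about [(T / 2) * mu], with [mu] at least the first
    nonzero eigenvalue of [- w'' = mu * f * w] on the circle.  For [f = 1] this
    is 1, and [tanh (T / 2) <= T / 2]; the point is that for
    [f = 1 + cos / 2 + cos (2 .) / 8] it exceeds 1.  To first order, the
    [cos (2 .)] term splits the double eigenvalue of the modes [cos] and [sin],
    while the constraint that [f * w] has mean zero lowers the mass of the
    [cos] mode; the coefficients are balanced so that both modes have reduced
    mass 15/16.  The coupling with higher modes raises this by little, since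
    those modes have energy at least four times their mass ([refined_wirtinger]).
    The outcome is [weighted_poincare], with constant 497/512.

    [eigenvalue_gap] turns any such inequality on the slices of [U] into
    [T / 2 < sigma] when [T < 1/200].  One slice whose energy is the average
    over [0 <= t <= T] is found by the mean value theorem, and the boundary
    values differ from it, in square mean, by [O(T)] times the total energy
    ([slice_drift]).

    For the flat cylinder [tanh (T / 2)] is attained by
    [cosh (t - T / 2) * cos h].  Conversely the [cos] and [sin] coefficients of
    an eigenfunction solve [A'' = A] with boundary conditions that leave only
    [sigma = tanh (T / 2)] and [sigma = coth (T / 2)], unless they vanish
    ([mode_vanishes]); in that case the slices satisfy the Poincare inequality
    with constant 1/4, and [eigenvalue_gap] applies again. *)

(* Conversion must not unfold the trigonometric series. *)
Local Opaque sin cos.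

(** * Integration over the circle *)

Definition circ (g : R -> R) : R := RInt g 0 (2 * PI).
Definition cts (g : R -> R) : Prop := forall h, continuous g h.
Definition periodic (g : R -> R) : Prop := forall h, g (h + 2 * PI) = g h.

Lemma cts_const c : cts (fun _ => c).
Proof. intro h; apply continuous_const. Qed.
Lemma cts_plus f g : cts f -> cts g -> cts (fun x => f x + g x).
Proof. intros F G h; apply (continuous_plus f g); auto. Qed.
Lemma cts_opp f : cts f -> cts (fun x => - f x).
Proof. intros F h; apply (continuous_opp f); auto. Qed.
Lemma cts_minus f g : cts f -> cts g -> cts (fun x => f x - g x).
Proof. intros F G h; apply (continuous_minus f g); auto. Qed.
Lemma cts_mult f g : cts f -> cts g -> cts (fun x => f x * g x).
Proof. intros F G h; apply (continuous_mult f g); auto. Qed.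
Lemma cts_pow f n : cts f -> cts (fun x => f x ^ n).
Proof.
intros F; induction n as [|n IH]; simpl.
- apply cts_const.
- now apply cts_mult.
Qed.
Lemma cts_derive (f df : R -> R) : (forall h, is_derive f h (df h)) -> cts f.
Proof. intros D h; apply (ex_derive_continuous f); exists (df h); apply D. Qed.
Lemma sin_sq x : sin x * sin x = 1 - cos x * cos x.
Proof. generalize (sin2_cos2 x); unfold Rsqr; lra. Qed.

Lemma is_derive_cos x : is_derive cos x (- sin x).
Proof. auto_derive; auto; ring. Qed.

Lemma is_derive_sin x : is_derive sin x (cos x).
Proof. auto_derive; auto; ring. Qed.

Lemma periodic_cos : periodic cos.
Proof. intro h; rewrite cos_plus, cos_2PI, sin_2PI; ring. Qed.

Lemma periodic_sin : periodic sin.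
Proof. intro h; rewrite sin_plus, cos_2PI, sin_2PI; ring. Qed.

Lemma derive_cont (f : R -> R) df t : is_derive f t df -> continuity_pt f t.
Proof.
intro D; apply continuity_pt_filterlim, (ex_derive_continuous f); eexists; exact D.
Qed.

Lemma is_derive_shift (p q : R -> R) k : (forall x, is_derive p x (q x)) ->
  forall u, is_derive (fun z => p (z + k)) u (q (u + k)).
Proof.
intros D u; evar_last.
apply (is_derive_comp p (fun z => z + k)); [apply D | auto_derive; auto].
apply (scal_one (K := R_Ring)).
Qed.

Lemma cts_cos : cts cos.
Proof. exact (cts_derive _ _ is_derive_cos). Qed.
Lemma cts_sin : cts sin.
Proof. exact (cts_derive _ _ is_derive_sin). Qed.

Ltac cont := cbv beta; lazymatch goal with
  | |- cts (fun _ => ?c) => exact (cts_const c)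
  | |- cts (fun x => ?f x) => change (cts f); cont
  | |- cts (fun x => @?f x + @?g x) => refine (cts_plus f g _ _); cont
  | |- cts (fun x => @?f x - @?g x) => refine (cts_minus f g _ _); cont
  | |- cts (fun x => @?f x * @?g x) => refine (cts_mult f g _ _); cont
  | |- cts (fun x => - @?f x) => refine (cts_opp f _); cont
  | |- cts (fun x => @?f x ^ ?n) => refine (cts_pow f n _); cont
  | |- cts cos => exact cts_cos
  | |- cts sin => exact cts_sin
  | |- _ => try assumption
  end.

Lemma cts_ex_RInt g a b : cts g -> ex_RInt g a b.
Proof. intros G; apply (@ex_RInt_continuous R_CompleteNormedModule); intros; apply G. Qed.

Lemma two_PI_pos : 0 < 2 * PI.
Proof. generalize PI_RGT_0; lra. Qed.

Lemma circ_ext f g : (forall h, f h = g h) -> circ f = circ g.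
Proof. intros E; apply RInt_ext; intros; apply E. Qed.

Lemma RInt_lin k f g a b : cts f -> cts g ->
  RInt (fun h => f h + k * g h) a b = RInt f a b + k * RInt g a b.
Proof.
intros F G; apply is_RInt_unique.
apply (is_RInt_plus f (fun h => k * g h)).
- apply (@RInt_correct R_CompleteNormedModule), cts_ex_RInt, F.
- apply (is_RInt_scal g); apply (@RInt_correct R_CompleteNormedModule), cts_ex_RInt, G.
Qed.

Lemma circ_lin k f g : cts f -> cts g ->
  circ (fun h => f h + k * g h) = circ f + k * circ g.
Proof. exact (RInt_lin k f g 0 (2 * PI)). Qed.

Lemma circ_le f g : cts f -> cts g -> (forall h, f h <= g h) -> circ f <= circ g.
Proof.
intros F G E; generalize two_PI_pos; intro.
apply RInt_le; try apply cts_ex_RInt; auto; lra.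
Qed.

Lemma circ_const k : circ (fun _ => k) = 2 * PI * k.
Proof. unfold circ; rewrite RInt_const; unfold scal; simpl; unfold mult; simpl; ring. Qed.

Lemma circ_ge0 f : cts f -> (forall h, 0 <= f h) -> 0 <= circ f.
Proof.
intros F E; replace 0 with (circ (fun _ => 0)) by (rewrite circ_const; ring).
apply circ_le; auto; cont.
Qed.

Lemma circ_scal k g : cts g -> circ (fun h => k * g h) = k * circ g.
Proof.
intro G; rewrite (circ_ext _ (fun h => 0 + k * g h)) by (intro; ring).
rewrite (circ_lin k (fun _ => 0) g), circ_const by cont; ring.
Qed.

Ltac expand_circ := repeat match goal with
  | |- context [circ (fun h => @?f h + ?k * @?g h)] =>
      rewrite (circ_lin k f g) by (cont; auto); cbv beta
  | |- context [circ (fun h => ?f h)] => change (circ (fun h => f h)) with (circ f)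
  end.

(** For a trigonometric polynomial [g] of mean [k], an antiderivative of [g - k] is
    again a trigonometric polynomial; this is how the explicit integrals below
    are computed. *)
Lemma circ_mean (G g : R -> R) k : (forall h, is_derive G h (g h - k)) -> cts g ->
  G (2 * PI) = G 0 -> circ g = 2 * PI * k.
Proof.
intros D C E.
rewrite (circ_ext g (fun h => (g h - k) + 1 * k)) by (intro; ring).
rewrite (circ_lin 1 (fun h => g h - k) (fun _ => k)), circ_const by cont.
assert (H : circ (fun h => g h - k) = 0).
{ apply is_RInt_unique. replace 0 with (minus (G (2 * PI)) (G 0)) at 2.
  - apply (is_RInt_derive G); intros; [apply D|]. apply (cts_minus g (fun _ => k)); cont.
  - rewrite E; apply (minus_eq_zero (G 0 : R)). }
rewrite H; ring.
Qed.

Lemma circ_derive (G g : R -> R) : (forall h, is_derive G h (g h)) -> cts g -> periodic G ->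
  circ g = 0.
Proof.
intros D C P; rewrite (circ_mean G g 0); try ring; auto.
- intro h; rewrite Rminus_0_r; apply D.
- rewrite <- (P 0); f_equal; ring.
Qed.

Lemma is_derive_mult_R (f g df dg : R -> R) :
  (forall h, is_derive f h (df h)) -> (forall h, is_derive g h (dg h)) ->
  forall h, is_derive (fun x => f x * g x) h (df h * g h + f h * dg h).
Proof. intros F G h; apply (is_derive_mult f g); auto; intros; apply Rmult_comm. Qed.

Lemma circ_by_parts (u v du dv : R -> R) :
  (forall h, is_derive u h (du h)) -> (forall h, is_derive v h (dv h)) ->
  cts du -> cts dv -> periodic u -> periodic v ->
  circ (fun h => u h * dv h) = - circ (fun h => du h * v h).
Proof.
intros Du Dv Cu Cv Pu Pv.
assert (Ku := cts_derive _ _ Du); assert (Kv := cts_derive _ _ Dv).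
assert (H := circ_derive _ _ (is_derive_mult_R u v du dv Du Dv)).
rewrite (circ_ext _ (fun h => du h * v h + 1 * (u h * dv h))) in H by (intro; ring).
rewrite (circ_lin 1 (fun h => du h * v h) (fun h => u h * dv h)) in H by cont.
assert (circ (fun h => du h * v h) + 1 * circ (fun h => u h * dv h) = 0); [|lra].
apply H; [cont|]. intro h; rewrite Pu, Pv; reflexivity.
Qed.

Lemma circ_shift g a : cts g -> periodic g -> RInt g a (a + 2 * PI) = circ g.
Proof.
intros C P; unfold circ.
assert (E : forall x y, ex_RInt g x y) by (intros; apply cts_ex_RInt, C).
assert (S : RInt g (0 + 2 * PI) (a + 2 * PI) = RInt g 0 a).
{ generalize (RInt_comp_lin g 1 (2 * PI) 0 a (E _ _)).
  rewrite !Rmult_1_l; intro H; rewrite <- H; apply RInt_ext; intros.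
  unfold scal; simpl; unfold mult; simpl; rewrite !Rmult_1_l; apply P. }
generalize (RInt_Chasles g 0 a (a + 2 * PI) (E _ _) (E _ _)).
generalize (RInt_Chasles g 0 (0 + 2 * PI) (a + 2 * PI) (E _ _) (E _ _)).
rewrite S, Rplus_0_l; unfold plus; simpl; lra.
Qed.

Lemma circ_gt0 g x : cts g -> periodic g -> (forall h, 0 <= g h) -> 0 < g x ->
  0 < circ g.
Proof.
intros C P N X. generalize two_PI_pos; intro Pi.
rewrite <- (circ_shift g x C P).
assert (E : forall x y, ex_RInt g x y) by (intros; apply cts_ex_RInt, C).
destruct (proj1 (filterlim_locally g (g x)) (C x) (mkposreal _ X)) as [d Hd].
set (e := Rmin (d / 2) PI).
assert (He : 0 < e <= PI /\ e < d).
{ unfold e; generalize (cond_pos d) (Rmin_l (d / 2) PI) (Rmin_r (d / 2) PI) PI_RGT_0.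
  intros; repeat split; try lra. apply Rmin_glb_lt; lra. }
generalize (RInt_Chasles g x (x + e) (x + 2 * PI) (E _ _) (E _ _)); unfold plus; simpl.
assert (0 < RInt g x (x + e)).
{ apply RInt_gt_0; try lra.
  - intros y Hy. assert (B : ball x d y).
    { unfold ball; simpl; unfold AbsRing_ball, abs, minus, plus, opp; simpl.
      apply Rabs_def1; lra. }
    specialize (Hd y B); revert Hd.
    unfold ball; simpl; unfold AbsRing_ball, abs, minus, plus, opp; simpl.
    intro A; apply Rabs_def2 in A; lra.
  - intros; apply C. }
assert (0 <= RInt g (x + e) (x + 2 * PI)) by (apply RInt_ge_0; auto; lra).
lra.
Qed.

(** * Wirtinger's inequality beyond the first mode *)

(** The function [cos (l * (x - m))] is positive on the closed interval centred at
    [m] because [l < 2].  With [rho] its logarithmic derivative,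
    [g' ^ 2 - l ^ 2 * g ^ 2 = (g' - rho * g) ^ 2 + (rho * g ^ 2)'], and the last term
    integrates to zero.  At [l = 2] itself [rho] would blow up at the ends. *)
Lemma dirichlet_wirtinger_lt l (g dg : R -> R) a : 0 < l < 2 ->
  (forall h, is_derive g h (dg h)) -> cts dg -> g a = 0 -> g (a + PI / 2) = 0 ->
  l ^ 2 * RInt (fun h => g h ^ 2) a (a + PI / 2)
    <= RInt (fun h => dg h ^ 2) a (a + PI / 2).
Proof.
intros Hl D C A B. generalize PI_RGT_0; intro Pi.
assert (K := cts_derive _ _ D).
set (b := a + PI / 2) in *; set (m := a + PI / 4).
set (rho := fun x => - l * (sin (l * (x - m)) / cos (l * (x - m)))).
assert (Ab : Rmin a b = a /\ Rmax a b = b)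
  by (unfold b; split; [apply Rmin_left | apply Rmax_right]; lra).
destruct Ab as [Amin Amax].
assert (P : forall x, a <= x <= b -> 0 < cos (l * (x - m))).
{ intros x Hx; apply cos_gt_0.
  - assert (H : l * (m - x) <= l * (PI / 4)) by (apply Rmult_le_compat_l; unfold m, b in *; lra).
    assert (l * (PI / 4) < 2 * (PI / 4)) by (apply Rmult_lt_compat_r; lra). lra.
  - assert (H : l * (x - m) <= l * (PI / 4)) by (apply Rmult_le_compat_l; unfold m, b in *; lra).
    assert (l * (PI / 4) < 2 * (PI / 4)) by (apply Rmult_lt_compat_r; lra). lra. }
assert (Drho : forall x, a <= x <= b -> is_derive rho x (- l ^ 2 - rho x ^ 2)).
{ intros x Hx; specialize (P x Hx); unfold rho; auto_derive; [unfold Rminus in P; repeat split; apply Rgt_not_eq, P|].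
  assert (S := sin_sq (l * (x - m))).
  unfold Rminus in *; field_simplify_eq; [|lra]. ring [S]. }
assert (I : is_RInt (fun x => (- l ^ 2 - rho x ^ 2) * g x ^ 2 + 2 * rho x * g x * dg x)
   a b 0).
{ replace 0 with (minus ((fun x => rho x * g x ^ 2) b) ((fun x => rho x * g x ^ 2) a)).
  - apply (is_RInt_derive (fun x => rho x * g x ^ 2)); intros x; rewrite Amin, Amax; intro Hx.
    + specialize (Drho x Hx); specialize (D x).
      evar_last. apply (is_derive_mult rho (fun x => g x ^ 2)); [exact Drho| |intros; apply Rmult_comm].
      apply is_derive_pow; exact D.
      unfold plus, mult; simpl; ring.
    + assert (Cr : continuous rho x)
        by (apply (ex_derive_continuous rho); eexists; apply Drho, Hx).
      assert (Cm : forall u v : R -> R, continuous u x -> continuous v x ->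
          continuous (fun y => u y * v y) x) by (intros; apply (continuous_mult u v); auto).
      apply (continuous_plus (fun x => (- l ^ 2 - rho x ^ 2) * g x ^ 2)
        (fun x => 2 * rho x * g x * dg x)).
      * apply Cm; [|apply (cts_pow g 2 K)].
        apply (continuous_minus (fun _ => - l ^ 2) (fun x => rho x ^ 2)).
        apply continuous_const.
        simpl; repeat (apply Cm; auto); apply continuous_const.
      * repeat (apply Cm; auto); apply continuous_const.
  - simpl; rewrite A, B; unfold minus, plus, opp; simpl; ring. }
assert (H : RInt (fun x => (- l ^ 2 - rho x ^ 2) * g x ^ 2 + 2 * rho x * g x * dg x) a b
   <= RInt (fun x => dg x ^ 2 + - l ^ 2 * g x ^ 2) a b).
{ apply RInt_le.
  - unfold b; lra.
  - eexists; exact I.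
  - apply cts_ex_RInt; cont.
  - intros x _; generalize (pow2_ge_0 (dg x - rho x * g x)); simpl; lra. }
rewrite (is_RInt_unique _ _ _ _ I), (RInt_lin (- l ^ 2) (fun x => dg x ^ 2) (fun x => g x ^ 2)) in H
  by cont. lra.
Qed.

(** The limit [l -> 2]. *)
Lemma dirichlet_wirtinger (g dg : R -> R) a :
  (forall h, is_derive g h (dg h)) -> cts dg -> g a = 0 -> g (a + PI / 2) = 0 ->
  4 * RInt (fun h => g h ^ 2) a (a + PI / 2)
    <= RInt (fun h => dg h ^ 2) a (a + PI / 2).
Proof.
intros D C A B. generalize PI_RGT_0; intro Pi.
assert (K := cts_derive _ _ D).
assert (E : forall l, 0 < l < 2 -> l ^ 2 * RInt (fun h => g h ^ 2) a (a + PI / 2)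
    <= RInt (fun h => dg h ^ 2) a (a + PI / 2))
 by (intros; apply dirichlet_wirtinger_lt; auto).
assert (0 <= RInt (fun h => dg h ^ 2) a (a + PI / 2)).
{ apply RInt_ge_0; [lra| apply cts_ex_RInt; cont | intros; apply pow2_ge_0]. }
revert H E; generalize (RInt (fun h => dg h ^ 2) a (a + PI / 2)) as Y;
generalize (RInt (fun h => g h ^ 2) a (a + PI / 2)) as X.
clear; intros X Y HY E.
destruct (Rle_or_lt (4 * X) Y) as [|H]; auto; exfalso.
set (d := (4 * X - Y) / (8 * X)).
assert (dX : 8 * (d * X) = 4 * X - Y) by (unfold d; field; lra).
assert (0 < d) by (unfold d; apply Rdiv_lt_0_compat; lra).
assert (d <= 1 / 2) by (apply Rmult_le_reg_r with (8 * X); lra).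
specialize (E (2 - d)).
assert ((2 - d) ^ 2 * X = 4 * X - 4 * (d * X) + d ^ 2 * X) by ring.
assert (0 <= d ^ 2 * X) by (apply Rmult_le_pos; [apply pow2_ge_0 | lra]).
lra.
Qed.

(** Orthogonality to the eigenspaces 0 and 1 of [- d^2/dh^2] on the circle. *)
Definition ortho_low_modes (r : R -> R) : Prop :=
  circ r = 0 /\ circ (fun h => r h * cos h) = 0 /\ circ (fun h => r h * sin h) = 0.

(** Used both for functions and for their derivatives: on a first-mode combination
    the two norms agree, which is what makes the correction in
    [refined_wirtinger] harmless. *)
Lemma pythagoras r al be ga : cts r -> ortho_low_modes r ->
  circ (fun h => (al + be * cos h + ga * sin h + r h) ^ 2) =
  PI * (2 * al ^ 2 + be ^ 2 + ga ^ 2) + circ (fun h => r h ^ 2).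
Proof.
intros C (O1 & Oc & Os).
rewrite (circ_ext _ (fun h => ((((al + be * cos h + ga * sin h) ^ 2 + 1 * (r h ^ 2)) + (2 * al) * r h)
   + (2 * be) * (r h * cos h)) + (2 * ga) * (r h * sin h))) by (intro; ring).
expand_circ.
rewrite O1, Oc, Os.
rewrite (circ_mean (fun h : R => 2 * al * be * sin h - 2 * al * ga * cos h
  + (be ^ 2 - ga ^ 2) / 2 * (sin h * cos h) - be * ga * (cos h) ^ 2) 
   (fun h : R => (al + be * cos h + ga * sin h) ^ 2) (al ^ 2 + be ^ 2 / 2 + ga ^ 2 / 2)).
- field.
- intro h; auto_derive; auto.
  field_simplify_eq; ring [(sin_sq h)].
- cont.
- rewrite sin_2PI, cos_2PI, sin_0, cos_0. ring.
Qed.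

Lemma periodic_derive (g dg : R -> R) : (forall h, is_derive g h (dg h)) -> periodic g -> periodic dg.
Proof.
intros D P h. rewrite <- (is_derive_unique _ _ _ (D h)).
symmetry; apply is_derive_unique.
apply is_derive_ext with (fun z => g (z + 2 * PI)); [intro; apply P|].
apply (is_derive_shift g dg), D.
Qed.

Lemma ortho_derivative (r dr : R -> R) : (forall h, is_derive r h (dr h)) -> cts dr -> periodic r ->
  ortho_low_modes r -> ortho_low_modes dr.
Proof.
intros D C P (O1 & Oc & Os).
assert (K := cts_derive _ _ D).
repeat split.
- apply (circ_derive r); auto.
- generalize (circ_by_parts r cos dr (fun h => - sin h) D is_derive_cos C ltac:(cont) P periodic_cos).
  rewrite (circ_ext (fun h => r h * - sin h) (fun h => (-1) * (r h * sin h))) by (intro; ring).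
  rewrite (circ_scal (-1) (fun h => r h * sin h)), Os by cont. lra.
- generalize (circ_by_parts r sin dr cos D is_derive_sin C cts_cos P periodic_sin). lra.
Qed.

(** The alternating sum of [r] over the square inscribed at angle [a] changes sign
    when [a] is moved by a quarter turn. *)
Lemma alternating_zero r : cts r -> periodic r -> exists a,
  r a + r (a + PI) = r (a + PI / 2) + r (a + 3 * (PI / 2)).
Proof.
intros C P.
assert (C1 : forall k, cts (fun x => r (x + k))).
{ intros k x; apply (continuous_comp (fun x => x + k) r); [|apply C].
  apply (cts_plus (fun x => x) (fun _ => k)); intro; [apply continuous_id | apply continuous_const]. }
set (psi := fun x => r x - r (x + PI / 2) + r (x + PI) - r (x + 3 * (PI / 2))).
assert (K : continuity psi).
{ intro x; apply continuity_pt_filterlim.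
  apply (cts_minus (fun x => r x - r (x + PI / 2) + r (x + PI)) (fun x => r (x + 3 * (PI / 2)))); [|apply C1].
  apply (cts_plus (fun x => r x - r (x + PI / 2)) (fun x => r (x + PI))); [|apply C1].
  apply cts_minus; auto. }
assert (S : psi (PI / 2) = - psi 0).
{ unfold psi. rewrite <- (P 0), !Rplus_0_l.
  replace (PI / 2 + PI / 2) with PI by field.
  replace (PI / 2 + PI) with (3 * (PI / 2)) by field.
  replace (PI / 2 + 3 * (PI / 2)) with (2 * PI) by field. ring. }
destruct (IVT_gen psi 0 (PI / 2) 0 K) as [a [_ Ha]].
- rewrite S; unfold Rmin, Rmax; destruct (Rle_dec (psi 0) (- psi 0)); lra.
- exists a; unfold psi in Ha; lra.
Qed.

(** The combinations [al + be * cos h + ga * sin h] can interpolate [- r] at the four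
    vertices of a square exactly when the alternating sum of [r] over these
    vertices vanishes, and [alternating_zero] supplies such a square.  The
    corrected function [q] vanishes at four points a quarter turn apart, so
    [dirichlet_wirtinger] holds for it on each arc.  Since the correction is orthogonal
    to [r] and its energy is at most four times its mass, the inequality for
    [q] implies that for [r]. *)
Lemma refined_wirtinger (r dr : R -> R) : (forall h, is_derive r h (dr h)) -> cts dr -> periodic r ->
  ortho_low_modes r ->
  4 * circ (fun h => r h ^ 2) <= circ (fun h => dr h ^ 2).
Proof.
intros D C P O.
assert (K := cts_derive _ _ D).
assert (Od := ortho_derivative r dr D C P O).
destruct (alternating_zero r K P) as [a Ha].
assert (SC := sin_sq a).
set (al := - ((r a + r (a + PI)) / 2)).
set (x := (r a - r (a + PI)) / 2).
set (y := (r (a + PI / 2) - r (a + 3 * (PI / 2))) / 2).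
set (be := - (x * cos a - y * sin a)).
set (ga := - (x * sin a + y * cos a)).
set (q := fun h : R => al + be * cos h + ga * sin h + r h).
set (dq := fun h => 0 + ga * cos h + (- be) * sin h + dr h).
assert (Dq : forall h, is_derive q h (dq h)).
{ intro h; evar_last.
  apply (is_derive_plus (fun h => al + be * cos h + ga * sin h) r); [auto_derive; auto | apply D].
  unfold plus, dq; simpl; ring. }
assert (Cq : cts dq) by (unfold dq; cont).
assert (Kq := cts_derive _ _ Dq).
assert (Pq : periodic q).
{ intro h; unfold q; rewrite P, periodic_cos, periodic_sin; ring. }
assert (Pdq := periodic_derive _ _ Dq Pq).
assert (Z0 : q a = 0).
{ transitivity (al - x * (cos a * cos a + sin a * sin a) + r a); [unfold q, be, ga; ring|].
  rewrite SC; unfold al, x; field. }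
assert (Z1 : q (a + PI / 2) = 0).
{ unfold q; rewrite cos_plus, sin_plus, cos_PI2, sin_PI2.
  transitivity (al - y * (cos a * cos a + sin a * sin a) + r (a + PI / 2)); [unfold be, ga; ring|].
  rewrite SC; unfold al, y; lra. }
assert (Z2 : q (a + PI / 2 + PI / 2) = 0).
{ replace (a + PI / 2 + PI / 2) with (a + PI) by field.
  unfold q; rewrite cos_plus, sin_plus, cos_PI, sin_PI.
  transitivity (al + x * (cos a * cos a + sin a * sin a) + r (a + PI)); [unfold be, ga; ring|].
  rewrite SC; unfold al, x; field. }
assert (Z3 : q (a + PI / 2 + PI / 2 + PI / 2) = 0).
{ replace (a + PI / 2 + PI / 2 + PI / 2) with (a + 3 * (PI / 2)) by field.
  unfold q; rewrite cos_plus, sin_plus, cos_3PI2, sin_3PI2.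
  transitivity (al + y * (cos a * cos a + sin a * sin a) + r (a + 3 * (PI / 2))); [unfold be, ga; ring|].
  rewrite SC; unfold al, y; lra. }
assert (E4 : a + PI / 2 + PI / 2 + PI / 2 + PI / 2 = a + 2 * PI) by field.
assert (Z4 : q (a + PI / 2 + PI / 2 + PI / 2 + PI / 2) = 0) by (rewrite E4, Pq; exact Z0).
assert (Split : forall g, cts g -> periodic g -> circ g =
  RInt g a (a + PI / 2) + RInt g (a + PI / 2) (a + PI / 2 + PI / 2)
  + RInt g (a + PI / 2 + PI / 2) (a + PI / 2 + PI / 2 + PI / 2)
  + RInt g (a + PI / 2 + PI / 2 + PI / 2) (a + PI / 2 + PI / 2 + PI / 2 + PI / 2)).
{ intros g G Pg; rewrite E4, <- (circ_shift g a G Pg).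
  assert (E : forall x y, ex_RInt g x y) by (intros; apply cts_ex_RInt, G).
  assert (Ch : forall x y z, RInt g x z = RInt g x y + RInt g y z)
    by (intros; symmetry; apply (RInt_Chasles g); auto).
  rewrite (Ch a (a + PI / 2)), (Ch (a + PI / 2) (a + PI / 2 + PI / 2)),
    (Ch (a + PI / 2 + PI / 2) (a + PI / 2 + PI / 2 + PI / 2)); ring. }
assert (H : 4 * circ (fun h => q h ^ 2) <= circ (fun h => dq h ^ 2)).
{ rewrite (Split (fun h => q h ^ 2)), (Split (fun h => dq h ^ 2)); try cont;
   try (intro; now rewrite ?Pq, ?Pdq).
  generalize (dirichlet_wirtinger q dq _ Dq Cq Z0 Z1) (dirichlet_wirtinger q dq _ Dq Cq Z1 Z2)
   (dirichlet_wirtinger q dq _ Dq Cq Z2 Z3) (dirichlet_wirtinger q dq _ Dq Cq Z3 Z4).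
  lra. }
unfold q, dq in H.
rewrite (pythagoras r al be ga K O), (pythagoras dr 0 ga (- be) C Od) in H.
assert (0 <= PI * (8 * al ^ 2 + 3 * be ^ 2 + 3 * ga ^ 2)).
{ generalize PI_RGT_0 (pow2_ge_0 al) (pow2_ge_0 be) (pow2_ge_0 ga); intros.
  apply Rmult_le_pos; lra. }
lra.
Qed.

(** * A Poincare inequality for the weight *)

Lemma cts_scaled g k : cts g -> cts (fun h => g (k * h)).
Proof.
intros G h; apply (continuous_comp (fun h => k * h) g); [|apply G].
apply (cts_mult (fun _ => k) (fun h => h)); intro; [apply continuous_const | apply continuous_id].
Qed.

(** Multiplying the first mode by [f_warp] produces only the frequencies 2 and 3 besides
    constants and the first mode. *)
Definition modes23 (A B C D h : R) : R :=
  A * cos (2 * h) + B * sin (2 * h) + C * cos (3 * h) + D * sin (3 * h).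

Lemma cts_modes23 A B C D : cts (modes23 A B C D).
Proof.
assert (Cc := fun k => cts_scaled cos k cts_cos).
assert (Cs := fun k => cts_scaled sin k cts_sin).
unfold modes23; cont; auto.
Qed.

Lemma trig_2PI : sin (2 * (2 * PI)) = 0 /\ cos (2 * (2 * PI)) = 1 /\
  sin (3 * (2 * PI)) = 0 /\ cos (3 * (2 * PI)) = 1.
Proof.
rewrite !(sin_2a (2 * PI)), !(cos_2a (2 * PI)).
replace (3 * (2 * PI)) with (2 * (2 * PI) + 2 * PI) by ring.
rewrite sin_plus, cos_plus, !(sin_2a (2 * PI)), !(cos_2a (2 * PI)), sin_2PI, cos_2PI.
repeat split; ring.
Qed.

Lemma modes23_ortho A B C D : ortho_low_modes (modes23 A B C D).
Proof.
assert (T := trig_2PI); destruct T as (e1 & e2 & e3 & e4).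
repeat split.
- rewrite (circ_mean (fun h : R => A / 2 * sin (2 * h) - B / 2 * cos (2 * h)
    + C / 3 * sin (3 * h) - D / 3 * cos (3 * h)) _ 0); [ring | | apply cts_modes23 | ].
  + intro h; unfold modes23; auto_derive; auto; field.
  + rewrite e1, e2, e3, e4, (Rmult_0_r 2), (Rmult_0_r 3), sin_0, cos_0; ring.
- rewrite (circ_mean (fun h : R =>
      A / 3 * (2 * sin (2 * h) * cos h - cos (2 * h) * sin h)
    - B / 3 * (2 * cos (2 * h) * cos h + sin (2 * h) * sin h)
    + C / 8 * (3 * sin (3 * h) * cos h - cos (3 * h) * sin h)
    - D / 8 * (3 * cos (3 * h) * cos h + sin (3 * h) * sin h)) _ 0);
    [ring | | apply cts_mult; [apply cts_modes23 | cont] | ].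
  + intro h; unfold modes23; auto_derive; auto; field.
  + rewrite e1, e2, e3, e4, sin_2PI, cos_2PI, (Rmult_0_r 2), (Rmult_0_r 3), sin_0, cos_0; ring.
- rewrite (circ_mean (fun h : R =>
      A / 3 * (cos (2 * h) * cos h + 2 * sin (2 * h) * sin h)
    + B / 3 * (sin (2 * h) * cos h - 2 * cos (2 * h) * sin h)
    + C / 8 * (cos (3 * h) * cos h + 3 * sin (3 * h) * sin h)
    + D / 8 * (sin (3 * h) * cos h - 3 * cos (3 * h) * sin h)) _ 0);
    [ring | | apply cts_mult; [apply cts_modes23 | cont] | ].
  + intro h; unfold modes23; auto_derive; auto; field.
  + rewrite e1, e2, e3, e4, sin_2PI, cos_2PI, (Rmult_0_r 2), (Rmult_0_r 3), sin_0, cos_0; ring.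
Qed.

Lemma modes23_norm A B C D :
  circ (fun h => modes23 A B C D h ^ 2) = PI * (A ^ 2 + B ^ 2 + C ^ 2 + D ^ 2).
Proof.
assert (T := trig_2PI); destruct T as (e1 & e2 & e3 & e4).
rewrite (circ_mean (fun h : R =>
    (A ^ 2 - B ^ 2) / 4 * (sin (2 * h) * cos (2 * h)) + A * B / 2 * sin (2 * h) ^ 2
  + (C ^ 2 - D ^ 2) / 6 * (sin (3 * h) * cos (3 * h)) + C * D / 3 * sin (3 * h) ^ 2
  + 2 * A * C / 5 * (3 * cos (2 * h) * sin (3 * h) - 2 * sin (2 * h) * cos (3 * h))
  + 2 * B * D / 5 * (2 * cos (2 * h) * sin (3 * h) - 3 * sin (2 * h) * cos (3 * h))
  + 2 * B * C / 5 * (3 * sin (2 * h) * sin (3 * h) + 2 * cos (2 * h) * cos (3 * h))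
  - 2 * A * D / 5 * (2 * sin (2 * h) * sin (3 * h) + 3 * cos (2 * h) * cos (3 * h)))
  _ ((A ^ 2 + B ^ 2 + C ^ 2 + D ^ 2) / 2)); [field | | apply cts_pow, cts_modes23 | ].
- intro h; unfold modes23; auto_derive; auto.
  field_simplify_eq; ring [(sin_sq (2 * h)) (sin_sq (3 * h))].
- rewrite e1, e2, e3, e4, (Rmult_0_r 2), (Rmult_0_r 3), sin_0, cos_0; ring.
Qed.

Lemma circ_trig2 : circ cos = 0 /\ circ sin = 0 /\ circ (fun h => cos h * cos h) = PI /\
  circ (fun h => sin h * sin h) = PI /\ circ (fun h => sin h * cos h) = 0.
Proof.
repeat split.
- rewrite (circ_mean (fun h : R => sin h) _ 0); [ring | | cont | ].
  intro h; auto_derive; auto; ring. now rewrite sin_2PI, sin_0.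
- rewrite (circ_mean (fun h : R => - cos h) _ 0); [ring | | cont | ].
  intro h; auto_derive; auto; ring. now rewrite cos_2PI, cos_0.
- rewrite (circ_mean (fun h : R => sin h * cos h / 2) _ (/ 2)); [field | | cont | ].
  intro h; auto_derive; auto; field_simplify_eq; ring [(sin_sq h)]. now rewrite sin_2PI, cos_2PI, sin_0, cos_0.
- rewrite (circ_mean (fun h : R => - (sin h * cos h) / 2) _ (/ 2)); [field | | cont | ].
  intro h; auto_derive; auto; field_simplify_eq; ring [(sin_sq h)]. now rewrite sin_2PI, cos_2PI, sin_0, cos_0.
- rewrite (circ_mean (fun h : R => sin h ^ 2 / 2) _ 0); [ring | | cont | ].
  intro h; auto_derive; auto; field. now rewrite sin_2PI, sin_0.
Qed.

(** The derivative is written in the shape to which [pythagoras] applies. *)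
Lemma low_mode_decomposition (w dw : R -> R) :
  (forall h, is_derive w h (dw h)) -> cts dw -> periodic w ->
  exists a0 a b r dr,
    (forall h, w h = a0 + a * cos h + b * sin h + r h) /\
    (forall h, dw h = 0 + b * cos h + (- a) * sin h + dr h) /\
    (forall h, is_derive r h (dr h)) /\ cts dr /\ periodic r /\ ortho_low_modes r.
Proof.
intros D C P. assert (K := cts_derive _ _ D). generalize PI_RGT_0; intro Pi.
destruct circ_trig2 as (Ic & Is & Icc & Iss & Isc).
set (a0 := circ w / (2 * PI)).
set (a := circ (fun h => w h * cos h) / PI).
set (b := circ (fun h => w h * sin h) / PI).
exists a0, a, b, (fun h => w h - (a0 + a * cos h + b * sin h)),
  (fun h => dw h - (b * cos h - a * sin h)).
split; [intro; ring|]. split; [intro; ring|]. split.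
{ intro h; evar_last.
  apply (is_derive_minus w (fun h => a0 + a * cos h + b * sin h)); [apply D | auto_derive; auto].
  unfold minus, plus, opp; simpl; ring. }
split; [cont|]. split.
{ intro h; rewrite P, periodic_cos, periodic_sin; ring. }
repeat split.
- rewrite (circ_ext _ (fun h => ((w h + (- a0) * 1) + (- a) * cos h) + (- b) * sin h)) by (intro; ring).
  expand_circ; rewrite  Ic, Is, circ_const.
  unfold a0; field; lra.
- rewrite (circ_ext _ (fun h => ((w h * cos h + (- a0) * cos h) + (- a) * (cos h * cos h)) + (- b) * (sin h * cos h))) by (intro; ring).
  expand_circ; rewrite  Ic, Icc, Isc.
  unfold a; field; lra.
- rewrite (circ_ext _ (fun h => ((w h * sin h + (- a0) * sin h) + (- a) * (sin h * cos h)) + (- b) * (sin h * sin h))) by (intro; ring).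
  expand_circ; rewrite  Is, Iss, Isc.
  unfold b; field; lra.
Qed.

Lemma f_warp_poly h : f_warp h = 7 / 8 + / 2 * cos h + / 4 * (cos h * cos h).
Proof.
unfold f_warp; rewrite cos_2a, sin_sq; field.
Qed.

Lemma f_warp_bounds h : 0 < f_warp h <= 13 / 8.
Proof.
rewrite f_warp_poly; generalize (COS_bound h); intro B; split.
- generalize (pow2_ge_0 (cos h + 1)); lra.
- assert (cos h * cos h <= 1) by nra. lra.
Qed.

Lemma cts_f_warp : cts f_warp.
Proof.
unfold f_warp; cont; apply (cts_scaled cos 2 cts_cos).
Qed.

Lemma cos_3a h : cos (3 * h) = 4 * cos h ^ 3 - 3 * cos h.
Proof.
replace (3 * h) with (2 * h + h) by ring; rewrite cos_plus, cos_2a, sin_2a.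
ring [(sin_sq h)].
Qed.

Lemma sin_3a h : sin (3 * h) = (4 * cos h ^ 2 - 1) * sin h.
Proof.
replace (3 * h) with (2 * h + h) by ring; rewrite sin_plus, cos_2a, sin_2a.
ring [(sin_sq h)].
Qed.

(** The shift [- a / 4] is chosen to cancel the constant Fourier coefficient of the
    left-hand side.  That both modes come out with the same coefficient 15/16 is
    the balance between the two coefficients of [f_warp]. *)
Lemma f_warp_low_mode a b h :
  f_warp h * (a * cos h + b * sin h - a / 4) =
  15 / 16 * (a * cos h + b * sin h) + modes23 (7 / 32 * a) (b / 4) (a / 16) (b / 16) h.
Proof.
unfold modes23; rewrite f_warp_poly, cos_3a, sin_3a, cos_2a, sin_2a.
field_simplify_eq; ring [(sin_sq h)].
Qed.

(** Decompose [w = a0 + p + r] with [p] in the first mode and [r] orthogonal to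
    the low modes, and take [c = a0 + a / 4].  By [f_warp_low_mode] the [p] part
    contributes 15/16 of its mass and is coupled to [r] only through [G], which is
    small.  By Young's inequality [2 * G * r <= G ^ 2 / 2 + 2 * r ^ 2]; the first
    term costs 17/512 of the mass of [p], for a total of 497/512, and
    [(13/8 + 2) / 4 = 464/512] is what [refined_wirtinger] gives for [r]. *)
Lemma weighted_poincare (w dw : R -> R) :
  (forall h, is_derive w h (dw h)) -> cts dw -> periodic w ->
  exists c, circ (fun h => f_warp h * (w h - c) ^ 2) <= 497 / 512 * circ (fun h => dw h ^ 2).
Proof.
intros D C P. assert (K := cts_derive _ _ D). generalize PI_RGT_0; intro Pi.
destruct (low_mode_decomposition w dw D C P) as (a0 & a & b & r & dr & Ew & Ed & Dr & Cr & Pr & Or).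
assert (Kr := cts_derive _ _ Dr).
exists (a0 + a / 4).
rewrite (circ_ext (fun h => dw h ^ 2) (fun h => (0 + b * cos h + (- a) * sin h + dr h) ^ 2))
  by (intro; now rewrite Ed).
rewrite (pythagoras dr) by (try apply (ortho_derivative r); assumption).
assert (W := refined_wirtinger r dr Dr Cr Pr Or).
set (G := modes23 (7 / 32 * a) (b / 4) (a / 16) (b / 16)).
assert (CG : cts G) by apply cts_modes23.
assert (NG := modes23_norm (7 / 32 * a) (b / 4) (a / 16) (b / 16)); fold G in NG.
destruct (modes23_ortho (7 / 32 * a) (b / 4) (a / 16) (b / 16)) as (G1 & Gc & Gs); fold G in G1, Gc, Gs.
assert (FG : forall h, f_warp h * (a * cos h + b * sin h - a / 4) =
  15 / 16 * (a * cos h + b * sin h) + G h) by (intro; apply f_warp_low_mode).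
clearbody G.
destruct circ_trig2 as (Ic & Is & Icc & Iss & Isc).
destruct Or as (O1 & Oc & Os).
assert (CF := cts_f_warp).
apply Rle_trans with (circ (fun h =>
  (((((((((((0 + (15 / 16 * a ^ 2) * (cos h * cos h)) + (15 / 8 * a * b) * (sin h * cos h))
  + (15 / 16 * b ^ 2) * (sin h * sin h)) + (- (15 / 64) * a ^ 2) * cos h)
  + (- (15 / 64) * a * b) * sin h) + a * (G h * cos h)) + b * (G h * sin h))
  + (- a / 4) * G h) + (15 / 8 * a) * (r h * cos h)) + (15 / 8 * b) * (r h * sin h))
  + (1 / 2) * (G h ^ 2)) + (29 / 8) * (r h ^ 2))).
- apply circ_le; [cont | cont | ].
  intro h. rewrite Ew.
  replace (f_warp h * (a0 + a * cos h + b * sin h + r h - (a0 + a / 4)) ^ 2) with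
   ((f_warp h * (a * cos h + b * sin h - a / 4)) * ((a * cos h + b * sin h - a / 4) + 2 * r h)
     + f_warp h * r h ^ 2) by ring.
  rewrite FG.
  assert (f_warp h * r h ^ 2 <= 13 / 8 * r h ^ 2)
    by (apply Rmult_le_compat_r; [apply pow2_ge_0 | apply f_warp_bounds]).
  assert (Y := pow2_ge_0 (G h - 2 * r h)).
  lra.
- expand_circ; rewrite circ_const.
  rewrite Ic, Is, Icc, Iss, Isc, Oc, Os, G1, Gc, Gs, NG.
  assert (0 <= PI * a ^ 2) by (apply Rmult_le_pos; [lra | apply pow2_ge_0]).
  assert (0 <= PI * b ^ 2) by (apply Rmult_le_pos; [lra | apply pow2_ge_0]).
  assert (0 <= circ (fun h => dr h ^ 2)) by (apply circ_ge0; [cont | intro; apply pow2_ge_0]).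
  lra.
Qed.

(** * Harmonic functions on a short cylinder *)

Lemma smooth_continuous U : smooth_cylinder U -> forall t h, continuity_2d_pt U t h.
Proof. intros [_ S] t h; exact (proj1 (S 0%nat t h)). Qed.

Lemma smooth_is_derive_t U : smooth_cylinder U ->
  forall t h, is_derive (fun z => U z h) t (D_t U t h).
Proof. intros [_ S] t h; apply Derive_correct; destruct (S 1%nat t h) as (_ & E & _); exact E. Qed.

Lemma smooth_is_derive_h U : smooth_cylinder U ->
  forall t h, is_derive (U t) h (D_h U t h).
Proof. intros [_ S] t h; apply Derive_correct; destruct (S 1%nat t h) as (_ & _ & E & _); exact E. Qed.

Lemma smooth_D_t U : smooth_cylinder U -> smooth_cylinder (D_t U).
Proof.
intros [P S]; split.
- intros t h; unfold D_t; apply Derive_ext; intro; apply P.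
- intros n t h; destruct (S (Datatypes.S n) t h) as (_ & _ & _ & E & _); exact E.
Qed.

Lemma smooth_D_h U : smooth_cylinder U -> smooth_cylinder (D_h U).
Proof.
intros S; split.
- intro t; apply (periodic_derive (U t)); [apply (smooth_is_derive_h U S) | exact (proj1 S t)].
- intros n t h; destruct S as [_ S]; destruct (S (Datatypes.S n) t h) as (_ & _ & _ & _ & E); exact E.
Qed.

Lemma smooth_cts U : smooth_cylinder U -> forall t, cts (U t).
Proof. intros S t; exact (cts_derive _ _ (smooth_is_derive_h U S t)). Qed.

Lemma continuity_2d_snd f t h : cts f -> continuity_2d_pt (fun _ v => f v) t h.
Proof.
intro C; apply (continuity_1d_2d_pt_comp f (fun _ v => v)); [|apply continuity_2d_pt_id2].
apply continuity_pt_filterlim, C.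
Qed.

Lemma is_derive_circ (F dF : R -> R -> R) :
  (forall t h, is_derive (fun z => F z h) t (dF t h)) ->
  (forall t h, continuity_2d_pt dF t h) -> (forall t, cts (F t)) ->
  forall t, is_derive (fun z => circ (F z)) t (circ (dF t)).
Proof.
intros D C K t.
assert (E : forall u v, Derive (fun z => F z v) u = dF u v)
  by (intros; apply is_derive_unique, D).
rewrite (circ_ext (dF t) (fun h => Derive (fun z => F z h) t)) by (intro; now rewrite E).
apply (is_derive_RInt_param (fun z h => F z h)).
- apply filter_forall; intros; eexists; apply D.
- intros; apply continuity_2d_pt_ext with dF; [intros; now rewrite E | apply C].
- apply filter_forall; intros; apply cts_ex_RInt, K.
Qed.

(** The Steklov problem for a metric conformal to the flat one with factor [f ^ 2],
    expressed through the flat Laplacian; the outward normal derivative is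
    [- D_t U / f] at [t = 0] and [D_t U / f] at [t = T]. *)
Definition conformal_steklov (f : R -> R) (T sigma : R) (U : R -> R -> R) : Prop :=
  smooth_cylinder U /\
  (forall t h, 0 < t < T -> D_t (D_t U) t h + D_h (D_h U) t h = 0) /\
  (forall h, D_t U T h = sigma * (f h * U T h)) /\
  (forall h, D_t U 0 h = - sigma * (f h * U 0 h)).

Lemma constant_on T (g dg : R -> R) : 0 < T -> (forall t, is_derive g t (dg t)) ->
  (forall t, 0 < t < T -> dg t = 0) -> forall t, 0 <= t <= T -> g t = g 0.
Proof.
intros HT D Z t Ht.
destruct (MVT_gen g 0 t (fun _ => 0)) as [c [_ E]].
- intros x; rewrite Rmin_left, Rmax_right by lra; intro Hx.
  rewrite <- (Z x) by lra; apply D.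
- intros; eapply derive_cont, D.
- lra.
Qed.

(** The total flux [circ (D_t U t)] does not depend on [t], as the angular part of
    the Laplacian integrates to zero over the circle. *)
Lemma flux_balance f T sigma U : conformal_steklov f T sigma U -> 0 < T -> cts f ->
  sigma <> 0 -> circ (fun h => f h * U 0 h) + circ (fun h => f h * U T h) = 0.
Proof.
intros (S & L & B1 & B0) HT Cf Hs.
assert (St := smooth_D_t U S); assert (Stt := smooth_D_t _ St).
assert (Sh := smooth_D_h U S); assert (Shh := smooth_D_h _ Sh).
assert (K := smooth_cts U S).
assert (E : circ (D_t U T) = circ (D_t U 0)).
{ apply (constant_on T (fun t => circ (D_t U t)) (fun t => circ (D_t (D_t U) t))); try lra.
  - apply is_derive_circ; [apply smooth_is_derive_t | apply smooth_continuous | apply smooth_cts]; auto.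
  - intros t Ht.
    rewrite (circ_ext _ (fun h => (-1) * D_h (D_h U) t h))
      by (intro h; specialize (L t h Ht); lra).
    rewrite (circ_scal (-1) (D_h (D_h U) t)) by (apply smooth_cts; auto).
    rewrite (circ_derive (D_h U t) (D_h (D_h U) t)); [ring | | apply smooth_cts; auto | exact (proj1 Sh t)].
    apply smooth_is_derive_h; auto. }
rewrite (circ_ext (D_t U T) (fun h => sigma * (f h * U T h))) in E
  by (intro; rewrite B1; ring).
rewrite (circ_ext (D_t U 0) (fun h => (- sigma) * (f h * U 0 h))) in E
  by (intro; rewrite B0; ring).
rewrite (circ_scal sigma (fun h => f h * U T h)) in E by (cont; apply K).
rewrite (circ_scal (- sigma) (fun h => f h * U 0 h)) in E by (cont; apply K).
assert (sigma * (circ (fun h => f h * U 0 h) + circ (fun h => f h * U T h)) = 0) by lra.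
apply Rmult_integral in H; tauto.
Qed.

(** By Green's formula, the increase of [energy_flux] between two slices is the
    Dirichlet energy between them.  Using it in place of that energy avoids
    integrals over the cylinder. *)
Definition energy_flux (U : R -> R -> R) (t : R) : R := circ (fun h => U t h * D_t U t h).
Definition slice_energy (U : R -> R -> R) (t : R) : R :=
  circ (fun h => D_t U t h ^ 2) + circ (fun h => D_h U t h ^ 2).

Lemma slice_energy_ge U t : smooth_cylinder U ->
  0 <= circ (fun h => D_t U t h ^ 2) <= slice_energy U t /\
  circ (fun h => D_h U t h ^ 2) <= slice_energy U t.
Proof.
intro S. unfold slice_energy.
assert (0 <= circ (fun h => D_t U t h ^ 2)).
{ apply circ_ge0; [|intro; apply pow2_ge_0]. cont. apply smooth_cts, smooth_D_t, S. }
assert (0 <= circ (fun h => D_h U t h ^ 2)).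
{ apply circ_ge0; [|intro; apply pow2_ge_0]. cont. apply smooth_cts, smooth_D_h, S. }
lra.
Qed.

Lemma continuity_2d_sq F : (forall t h, continuity_2d_pt F t h) ->
  forall t h, continuity_2d_pt (fun u v => F u v ^ 2) t h.
Proof.
intros C t h; apply continuity_2d_pt_ext with (fun u v => F u v * F u v); [intros; ring|].
apply continuity_2d_pt_mult; apply C.
Qed.

Lemma is_derive_energy_flux U : smooth_cylinder U -> forall t,
  is_derive (energy_flux U) t (circ (fun h => D_t U t h ^ 2 + U t h * D_t (D_t U) t h)).
Proof.
intros S.
assert (St := smooth_D_t U S); assert (Stt := smooth_D_t _ St).
apply (is_derive_circ (fun t h => U t h * D_t U t h)
  (fun t h => D_t U t h ^ 2 + U t h * D_t (D_t U) t h)).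
- intros t h; evar_last.
  apply (is_derive_mult (fun z => U z h) (fun z => D_t U z h));
    [apply smooth_is_derive_t, S | apply smooth_is_derive_t, St | intros; apply Rmult_comm].
  unfold plus, mult; simpl; ring.
- intros t h; apply continuity_2d_pt_plus; [apply continuity_2d_sq, smooth_continuous, St|].
  apply continuity_2d_pt_mult; apply smooth_continuous; auto.
- intro t; cont; apply smooth_cts; auto.
Qed.

Lemma energy_flux_interior U T : smooth_cylinder U ->
  (forall t h, 0 < t < T -> D_t (D_t U) t h + D_h (D_h U) t h = 0) ->
  forall t, 0 < t < T -> is_derive (energy_flux U) t (slice_energy U t).
Proof.
intros S L t Ht.
assert (St := smooth_D_t U S). assert (Sh := smooth_D_h U S); assert (Shh := smooth_D_h _ Sh).
assert (K := smooth_cts U S t). assert (Kt := smooth_cts _ St t).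
assert (Kh := smooth_cts _ Sh t). assert (Khh := smooth_cts _ Shh t).
evar_last; [apply is_derive_energy_flux, S|]. unfold slice_energy.
rewrite (circ_ext _ (fun h => D_t U t h ^ 2 + (-1) * (U t h * D_h (D_h U) t h)))
  by (intro h; specialize (L t h Ht); replace (D_t (D_t U) t h) with (- D_h (D_h U) t h) by lra; ring).
expand_circ.
rewrite (circ_by_parts (U t) (D_h U t) (D_h U t) (D_h (D_h U) t)); auto.
- rewrite (circ_ext (fun h => D_h U t h * D_h U t h) (fun h => D_h U t h ^ 2)) by (intro; ring).
  ring.
- apply smooth_is_derive_h, S.
- apply smooth_is_derive_h, Sh.
- exact (proj1 S t).
- exact (proj1 Sh t).
Qed.

(** A bound by the energy between the two slices.  With
    [phi = 1 - (t - t2) / (2 * T)], which stays between 1/2 and 1, the quantity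
    [phi * hh - 2 * T * energy_flux U] is nonincreasing: the derivative
    [- hh / (2 * T)] coming from [phi] absorbs the cross term
    [2 * (U - U t2) * D_t U]. *)
Lemma slice_drift U T t2 t1 : smooth_cylinder U ->
  (forall t h, 0 < t < T -> D_t (D_t U) t h + D_h (D_h U) t h = 0) ->
  0 <= t2 <= t1 -> t1 <= T -> 0 < T ->
  circ (fun h => (U t1 h - U t2 h) ^ 2) <= 4 * T * (energy_flux U t1 - energy_flux U t2).
Proof.
intros S L H21 H1 HT.
assert (St := smooth_D_t U S).
assert (K := smooth_cts U S). assert (Kt := smooth_cts _ St).
set (phi := fun t => 1 - (t - t2) / (2 * T)).
set (hh := fun t => circ (fun h => (U t h - U t2 h) ^ 2)).
set (dh := fun t => circ (fun h => 2 * (U t h - U t2 h) * D_t U t h)).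
set (dG := fun t => - / (2 * T) * hh t + phi t * dh t - 2 * T * slice_energy U t).
assert (Phi : forall t, t2 <= t <= t1 -> / 2 <= phi t <= 1).
{ intros t Ht; unfold phi; assert (0 <= (t - t2) / (2 * T)) by (apply Rdiv_le_0_compat; lra).
  assert ((t - t2) / (2 * T) <= / 2); [|lra].
  apply Rmult_le_reg_r with (2 * T); [lra|]. field_simplify; lra. }
assert (Dh : forall t, is_derive hh t (dh t)).
{ apply (is_derive_circ (fun t h => (U t h - U t2 h) ^ 2)
    (fun t h => 2 * (U t h - U t2 h) * D_t U t h)).
  - intros t h; evar_last.
    apply is_derive_pow.
    apply (is_derive_minus (fun z => U z h) (fun _ => U t2 h));
      [apply smooth_is_derive_t, S | apply (is_derive_const (U t2 h))].
    unfold minus, plus, opp, zero; simpl; ring.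
  - intros t h; apply continuity_2d_pt_mult; [|apply smooth_continuous, St].
    apply continuity_2d_pt_mult; [apply continuity_2d_pt_const|].
    apply continuity_2d_pt_minus; [apply smooth_continuous, S | apply continuity_2d_snd, K].
  - intro t; cont; apply K. }
assert (E : exists c, t2 <= c <= t1 /\
   (phi t1 * hh t1 - 2 * T * energy_flux U t1) - (phi t2 * hh t2 - 2 * T * energy_flux U t2)
     = dG c * (t1 - t2)).
{ assert (Dphi : forall t, is_derive phi t (- / (2 * T))).
  { intro t; unfold phi; auto_derive; auto; field; lra. }
  destruct (MVT_gen (fun t => phi t * hh t - 2 * T * energy_flux U t) t2 t1 dG) as [c [Hc E]].
  - rewrite Rmin_left, Rmax_right by lra; intros t Ht. evar_last.
    apply (is_derive_minus (fun t => phi t * hh t) (fun t => 2 * T * energy_flux U t)).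
    + apply (is_derive_mult phi hh); [apply Dphi | apply Dh | intros; apply Rmult_comm].
    + apply (is_derive_scal (energy_flux U)), (energy_flux_interior U T); auto; lra.
    + unfold minus, plus, opp, scal, mult; simpl; unfold mult; simpl; unfold dG; ring.
  - intros t _; eapply derive_cont.
    apply (is_derive_minus (fun t => phi t * hh t) (fun t => 2 * T * energy_flux U t)).
    + apply (is_derive_mult phi hh); [apply Dphi | apply Dh | intros; apply Rmult_comm].
    + apply (is_derive_scal (energy_flux U)), is_derive_energy_flux, S.
  - rewrite Rmin_left, Rmax_right in Hc by lra; exists c; auto. }
destruct E as [c [Hc E]].
assert (N : dG c <= 0).
{ unfold dG. specialize (Phi c Hc).
  assert (phi c * dh c <= / (2 * T) * hh c + (2 * T) * circ (fun h => D_t U c h ^ 2)).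
  { unfold dh, hh.
    apply Rle_trans with (circ (fun h => phi c * (2 * (U c h - U t2 h) * D_t U c h))).
    { rewrite (circ_scal (phi c) (fun h => 2 * (U c h - U t2 h) * D_t U c h)) by (cont; auto); lra. }
    apply Rle_trans with (circ (fun h => (0 + / (2 * T) * (U c h - U t2 h) ^ 2) + 2 * T * D_t U c h ^ 2)).
    - apply circ_le; [cont; auto | cont; auto |]. intro h.
      set (x := U c h - U t2 h). set (y := D_t U c h).
      assert (Y : 0 <= / (2 * T) * (x - 2 * T * (phi c * y)) ^ 2).
      { apply Rmult_le_pos; [|apply pow2_ge_0]. apply Rlt_le, Rinv_0_lt_compat; lra. }
      replace (/ (2 * T) * (x - 2 * T * (phi c * y)) ^ 2) with
        (/ (2 * T) * x ^ 2 - phi c * (2 * x * y) + 2 * T * (phi c ^ 2 * y ^ 2)) in Y by (field; lra).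
      assert (phi c ^ 2 * y ^ 2 <= 1 * y ^ 2).
      { apply Rmult_le_compat_r; [apply pow2_ge_0|]. replace 1 with (1 ^ 2) by ring.
        apply pow_incr; lra. }
      assert (2 * T * (phi c ^ 2 * y ^ 2) <= 2 * T * (1 * y ^ 2)) by (apply Rmult_le_compat_l; lra).
      lra.
    - expand_circ; rewrite circ_const; lra. }
  assert (2 * T * circ (fun h => D_t U c h ^ 2) <= 2 * T * slice_energy U c).
  { apply Rmult_le_compat_l; [lra|]. exact (proj2 (proj1 (slice_energy_ge U c S))). }
  lra. }
assert (Z : hh t2 = 0).
{ unfold hh; rewrite (circ_ext _ (fun _ => 0)) by (intro; ring). rewrite circ_const; ring. }
assert (P1 := Phi t1 ltac:(lra)).
assert (0 <= hh t1) by (apply circ_ge0; [cont; auto | intro; apply pow2_ge_0]).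
assert (dG c * (t1 - t2) <= 0).
{ assert (0 <= (- dG c) * (t1 - t2)) by (apply Rmult_le_pos; lra). lra. }
assert (/ 2 * hh t1 <= phi t1 * hh t1) by (apply Rmult_le_compat_r; lra).
rewrite Z in E. fold (hh t1). lra.
Qed.

(** Two consequences of the boundary condition are used: the energy is [sigma * B],
    and [f * U] has total integral zero over the boundary ([flux_balance]), so that
    subtracting a constant from [U] can only increase [B].  Comparing both boundary
    slices with the slice [t] whose energy is [sigma * B / T] gives
    [B * T / 2 <= (65/64 * 497/512 + O(T ^ 2)) * sigma * B], and for [T < 1/200]
    the factor is below 1. *)
Lemma eigenvalue_gap f T sigma U : conformal_steklov f T sigma U ->
  0 < T < / 200 -> sigma <> 0 ->
  cts f -> periodic f -> (forall h, 0 < f h <= 13 / 8) ->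
  (exists x, U 0 x <> 0 \/ U T x <> 0) ->
  (forall t, 0 <= t <= T -> exists c,
     circ (fun h => f h * (U t h - c) ^ 2) <= 497 / 512 * circ (fun h => D_h U t h ^ 2)) ->
  T / 2 < sigma.
Proof.
intros CS HT Hs Cf Pf Bf [x Hx] Poin.
assert (FB := flux_balance f T sigma U CS ltac:(lra) Cf Hs).
destruct CS as (S & L & B1 & B0).
assert (St := smooth_D_t U S).
assert (K := smooth_cts U S). assert (Kt := smooth_cts _ St).
set (B := circ (fun h => f h * U 0 h ^ 2) + circ (fun h => f h * U T h ^ 2)).
assert (Bpos : 0 < B).
{ assert (N : forall t, 0 <= circ (fun h => f h * U t h ^ 2)).
  { intro t; apply circ_ge0; [cont; auto|]. intro h; apply Rmult_le_pos; [apply Rlt_le, Bf | apply pow2_ge_0]. }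
  assert (P : forall t, U t x <> 0 -> 0 < circ (fun h => f h * U t h ^ 2)).
  { intros t Ht; apply (circ_gt0 _ x); [cont; auto | | | ].
    - intro h; rewrite Pf; destruct S as [P _]; rewrite P; reflexivity.
    - intro h; apply Rmult_le_pos; [apply Rlt_le, Bf | apply pow2_ge_0].
    - apply Rmult_lt_0_compat; [apply Bf | apply pow2_gt_0, Ht]. }
  unfold B; generalize (N 0) (N T); destruct Hx as [Hx|Hx]; generalize (P _ Hx); lra. }
assert (EJ : energy_flux U T - energy_flux U 0 = sigma * B).
{ unfold energy_flux, B.
  rewrite (circ_ext (fun h => U T h * D_t U T h) (fun h => sigma * (f h * U T h ^ 2)))
    by (intro; rewrite B1; ring).
  rewrite (circ_ext (fun h => U 0 h * D_t U 0 h) (fun h => (- sigma) * (f h * U 0 h ^ 2)))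
    by (intro; rewrite B0; ring).
  rewrite (circ_scal sigma (fun h => f h * U T h ^ 2)), (circ_scal (- sigma) (fun h => f h * U 0 h ^ 2))
    by (cont; auto); ring. }
assert (Slice : exists t, 0 <= t <= T /\ slice_energy U t * T = sigma * B).
{ destruct (MVT_gen (energy_flux U) 0 T (slice_energy U)) as [c [Hc E]].
  - rewrite Rmin_left, Rmax_right by lra; apply energy_flux_interior; auto.
  - intros; eapply derive_cont, is_derive_energy_flux, S.
  - rewrite Rmin_left, Rmax_right in Hc by lra; exists c; split; auto. rewrite <- EJ, E; ring. }
destruct Slice as [t [Ht Et]].
destruct (slice_energy_ge U t S) as [_ Sh].
assert (Dr1 := slice_drift U T t T S L ltac:(lra) ltac:(lra) ltac:(lra)).
assert (Dr0 := slice_drift U T 0 t S L ltac:(lra) ltac:(lra) ltac:(lra)).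
rewrite (circ_ext _ (fun h => (U 0 h - U t h) ^ 2)) in Dr0 by (intro; ring).
destruct (Poin t Ht) as [c Hc].
(* (x + y)^2 <= (1 + 1/64) x^2 + (1 + 64) y^2, and 845/8 = 65 * 13/8. *)
assert (Near : forall v, cts v -> circ (fun h => f h * (v h - c) ^ 2) <=
   65 / 64 * circ (fun h => f h * (U t h - c) ^ 2) + 845 / 8 * circ (fun h => (v h - U t h) ^ 2)).
{ intros v Kv.
  apply Rle_trans with (circ (fun h => (0 + 65 / 64 * (f h * (U t h - c) ^ 2)) + 845 / 8 * (v h - U t h) ^ 2)).
  - apply circ_le; [cont; auto | cont; auto |]. intro h; specialize (Bf h).
    assert (Y : 0 <= f h * (U t h - c - 64 * (v h - U t h)) ^ 2)
      by (apply Rmult_le_pos; [lra | apply pow2_ge_0]).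
    assert (f h * (v h - U t h) ^ 2 <= 13 / 8 * (v h - U t h) ^ 2)
      by (apply Rmult_le_compat_r; [apply pow2_ge_0 | lra]).
    lra.
  - expand_circ; rewrite circ_const; lra. }
assert (Center : B <= circ (fun h => f h * (U 0 h - c) ^ 2) + circ (fun h => f h * (U T h - c) ^ 2)).
{ assert (X : forall v, cts v -> circ (fun h => f h * (v h - c) ^ 2) =
     circ (fun h => f h * v h ^ 2) + (- 2 * c) * circ (fun h => f h * v h) + c ^ 2 * circ f).
  { intros v Kv.
    rewrite (circ_ext _ (fun h => (f h * v h ^ 2 + (- 2 * c) * (f h * v h)) + c ^ 2 * f h)) by (intro; ring).
    expand_circ; reflexivity. }
  rewrite !X by auto.
  assert (0 <= c ^ 2 * circ f).
  { apply Rmult_le_pos; [apply pow2_ge_0 | apply circ_ge0; auto; intro; apply Rlt_le, Bf]. }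
  assert (c * (circ (fun h => f h * U 0 h) + circ (fun h => f h * U T h)) = 0) by (rewrite FB; ring).
  unfold B; lra. }
generalize (Near (U 0) (K 0)) (Near (U T) (K T)); intros N0 N1.
set (X := sigma * B) in *.
(* 32305/32768 = 65/64 * 497/512. *)
assert (Main : B <= 2 * (32305 / 32768) * slice_energy U t + 845 / 8 * (4 * T * X)).
{ rewrite <- EJ. lra. }
assert (TT : T * T <= / 40000).
{ replace (/ 40000) with (/ 200 * / 200) by field. apply Rmult_le_compat; lra. }
assert (MT : B * T <= 2 * (32305 / 32768) * X + 845 / 2 * (T * T) * X).
{ rewrite <- Et at 1.
  assert (B * T <= (2 * (32305 / 32768) * slice_energy U t + 845 / 8 * (4 * T * X)) * T)
    by (apply Rmult_le_compat_r; lra). lra. }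
assert (Xpos : 0 <= X).
{ rewrite <- Et. apply Rmult_le_pos; [|lra].
  destruct (slice_energy_ge U t S) as [[? ?] _]; lra. }
assert (T * T * X <= / 40000 * X) by (apply Rmult_le_compat_r; auto).
assert (BT : 0 < B * T) by (apply Rmult_lt_0_compat; lra).
assert (B * T < 2 * X) by lra.
unfold X in *. apply Rmult_lt_reg_r with B; lra.
Qed.

(** * Conformal metrics on the cylinder *)

Definition conformal_to (f : R -> R) (g : metric) : Prop :=
  forall t h, g_tt g t h = f h ^ 2 /\ g_th g t h = 0 /\ g_hh g t h = f h ^ 2.

Lemma conformal_det f g t h : conformal_to f g -> det_g g t h = (f h ^ 2) ^ 2.
Proof. intro Cg; unfold det_g; destruct (Cg t h) as (-> & -> & ->); ring. Qed.

Lemma conformal_grad_t f g U t h : (forall h, 0 < f h) -> conformal_to f g ->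
  grad_t g U t h = D_t U t h / f h ^ 2.
Proof.
intros Fpos Cg; unfold grad_t; rewrite (conformal_det f g _ _ Cg); destruct (Cg t h) as (_ & -> & ->).
specialize (Fpos h); field; lra.
Qed.

Lemma conformal_grad_h f g U t h : (forall h, 0 < f h) -> conformal_to f g ->
  grad_h g U t h = D_h U t h / f h ^ 2.
Proof.
intros Fpos Cg; unfold grad_h; rewrite (conformal_det f g _ _ Cg); destruct (Cg t h) as (-> & -> & _).
specialize (Fpos h); field; lra.
Qed.

Lemma conformal_sqrt_det f g t h : conformal_to f g -> sqrt (det_g g t h) = f h ^ 2.
Proof. intro Cg; rewrite (conformal_det f g t h Cg); apply sqrt_pow2, pow2_ge_0. Qed.

Lemma conformal_laplace f g U t h : (forall h, 0 < f h) -> conformal_to f g ->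
  laplace_beltrami g U t h = (D_t (D_t U) t h + D_h (D_h U) t h) / f h ^ 2.
Proof.
intros Fpos Cg; unfold laplace_beltrami; rewrite (conformal_sqrt_det f g _ _ Cg); f_equal; f_equal.
- apply Derive_ext; intro z; rewrite (conformal_sqrt_det f g _ _ Cg), (conformal_grad_t f g _ _ _ Fpos Cg).
  specialize (Fpos h); field; lra.
- apply Derive_ext; intro z; rewrite (conformal_sqrt_det f g _ _ Cg), (conformal_grad_h f g _ _ _ Fpos Cg).
  specialize (Fpos z); field; lra.
Qed.

Lemma conformal_normal f g T U i h : (forall h, 0 < f h) -> conformal_to f g ->
  normal_derivative g T U i h =
  (if i then 1 else -1) * D_t U (bd_t T i) h / f h.
Proof.
intros Fpos Cg; unfold normal_derivative; rewrite (conformal_grad_t f g _ _ _ Fpos Cg), (conformal_det f g _ _ Cg).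
destruct (Cg (bd_t T i) h) as (_ & _ & ->). specialize (Fpos h).
replace (f h ^ 2 / (f h ^ 2) ^ 2) with ((/ f h) ^ 2) by (field; lra).
rewrite sqrt_pow2 by (apply Rlt_le, Rinv_0_lt_compat; lra).
field; lra.
Qed.

(** Conformal invariance of the Laplacian reduces the Steklov problem to a flat one with
    weight [f] in the boundary condition. *)
Lemma eigenvalue_conformal_steklov f g T sigma :
  (forall h, 0 < f h) -> conformal_to f g -> steklov_eigenvalue g T sigma ->
  exists U, conformal_steklov f T sigma U /\ exists x, U 0 x <> 0 \/ U T x <> 0.
Proof.
intros Fpos Cg [u [[i [x Hx]] [_ [U [(S & L & B) N]]]]]; exists U; split.
- split; [exact S|]. split.
  + intros t h Ht; specialize (L t h Ht); rewrite (conformal_laplace f g _ _ _ Fpos Cg) in L.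
    specialize (Fpos h). apply Rmult_eq_reg_r with (/ f h ^ 2).
    * unfold Rdiv in L; rewrite L; ring.
    * apply Rinv_neq_0_compat, pow_nonzero; lra.
  + assert (Fn := fun h => Rgt_not_eq _ _ (Fpos h)).
    split; intro h.
    * generalize (N true h); rewrite (conformal_normal f g _ _ _ _ Fpos Cg), <- (B true h); simpl; intro E.
      transitivity (f h * (1 * D_t U T h / f h)); [field; auto | rewrite <- E; ring].
    * generalize (N false h); rewrite (conformal_normal f g _ _ _ _ Fpos Cg), <- (B false h); simpl; intro E.
      transitivity (- f h * (-1 * D_t U 0 h / f h)); [field; auto | rewrite <- E; ring].
- exists x; rewrite <- B in Hx; destruct i; auto.
Qed.

Lemma warped_conformal f : conformal_to f (warped_metric f).
Proof. intros t h; simpl; auto. Qed.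

Lemma product_conformal : conformal_to (fun _ => 1) product_metric.
Proof. intros t h; simpl; repeat split; ring. Qed.

(** * Hyperbolic functions and the threshold [T_10] *)

Lemma is_derive_sinh t : is_derive sinh t (cosh t).
Proof. apply is_derive_Reals, derivable_pt_lim_sinh. Qed.

Lemma is_derive_cosh t : is_derive cosh t (sinh t).
Proof. apply is_derive_Reals, derivable_pt_lim_cosh. Qed.

Lemma cosh2_sinh2 x : cosh x ^ 2 - sinh x ^ 2 = 1.
Proof.
unfold cosh, sinh; rewrite exp_Ropp; generalize (exp_pos x); intro; field; lra.
Qed.

Lemma sinh_opp x : sinh (- x) = - sinh x.
Proof. unfold sinh; rewrite Ropp_involutive; field. Qed.

Lemma cosh_opp x : cosh (- x) = cosh x.
Proof. unfold cosh; rewrite Ropp_involutive; field. Qed.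

Lemma cosh_pos x : 0 < cosh x.
Proof. unfold cosh; generalize (exp_pos x) (exp_pos (- x)); lra. Qed.

Lemma sinh_pos x : 0 < x -> 0 < sinh x.
Proof. intro H; rewrite <- sinh_0; now apply sinh_lt. Qed.

Lemma tanh_le_id x : 0 < x -> tanh x <= x.
Proof.
intro Hx; unfold tanh; apply Rmult_le_reg_r with (cosh x); [apply cosh_pos|].
replace (sinh x / cosh x * cosh x) with (sinh x) by (field; apply Rgt_not_eq, cosh_pos).
assert (D : forall z, is_derive (fun z => z * cosh z - sinh z) z (z * sinh z)).
{ intro z; evar_last.
  apply (is_derive_minus (fun z => z * cosh z) sinh); [|apply is_derive_sinh].
  apply (is_derive_mult (fun z => z) cosh);
    [apply (is_derive_id z) | apply is_derive_cosh | intros; apply Rmult_comm].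
  unfold minus, plus, opp, mult, one; simpl; ring. }
destruct (MVT_gen (fun z => z * cosh z - sinh z) 0 x (fun z => z * sinh z)) as [c [Hc E]].
- intros; apply D.
- intros; eapply derive_cont, D.
- rewrite Rmin_left, Rmax_right in Hc by lra.
  rewrite sinh_0 in E.
  assert (0 <= sinh c) by (destruct (Req_dec c 0) as [->|]; [rewrite sinh_0; lra | apply Rlt_le, sinh_pos; lra]).
  assert (0 <= c * sinh c * (x - 0)) by (apply Rmult_le_pos; [apply Rmult_le_pos|]; lra).
  lra.
Qed.

Lemma tanh_lt x y : x < y -> tanh x < tanh y.
Proof.
intro H; assert (Hx := cosh_pos x); assert (Hy := cosh_pos y).
assert (P := sinh_pos (y - x) ltac:(lra)).
assert (E : sinh (y - x) = sinh y * cosh x - cosh y * sinh x).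
{ unfold sinh, cosh; replace (- (y - x)) with (- y + x) by ring; unfold Rminus.
  rewrite !exp_plus; field. }
assert (Q : tanh y - tanh x = sinh (y - x) / (cosh x * cosh y)).
{ rewrite E; unfold tanh; field; lra. }
assert (0 < sinh (y - x) / (cosh x * cosh y)).
{ apply Rdiv_lt_0_compat; auto. now apply Rmult_lt_0_compat. }
lra.
Qed.

(** [T_10] is a definite description, so its positivity rests on unique solvability of
    [T * tanh (T / 2) = 2]: the left-hand side is continuous and increasing, vanishes
    at 0 and exceeds 2 at 4. *)
Lemma T_10_pos : 0 < T_10.
Proof.
assert (Pi := PI_RGT_0).
set (P := fun T : R => 0 < T /\ 4 * PI * tanh (T / 2) = 8 * PI / T).
assert (Char : forall T, P T <-> 0 < T /\ T * tanh (T / 2) = 2).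
{ intro T; unfold P; split; intros [HT E]; split; auto.
  - apply Rmult_eq_reg_l with (4 * PI); [|lra].
    transitivity (T * (4 * PI * tanh (T / 2))); [ring | rewrite E; field; lra].
  - transitivity (4 * PI / T * (T * tanh (T / 2))); [field; lra | rewrite E; field; lra]. }
enough (U : exists ! x, P x) by exact (proj1 (iota_correct P U)).
set (g := fun T => T * tanh (T / 2)).
assert (Cg : continuity g).
{ intro x; unfold g, tanh.
  assert (D : ex_derive (fun T => T * (sinh (T / 2) / cosh (T / 2))) x).
  { generalize (cosh_pos (x / 2)); unfold sinh, cosh; intro; auto_derive; lra. }
  destruct D as [l D]; exact (derive_cont _ _ _ D). }
assert (G4 : 2 <= g 4).
{ unfold g, tanh; replace (4 / 2) with 2 by field.
  apply Rmult_le_reg_r with (cosh 2); [apply cosh_pos|].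
  replace (4 * (sinh 2 / cosh 2) * cosh 2) with (4 * sinh 2) by (field; apply Rgt_not_eq, cosh_pos).
  unfold sinh, cosh.
  assert (1 + 2 < exp 2) by (apply exp_ineq1; lra).
  assert (exp (Ropp 2) < exp 0) by (apply exp_increasing; lra).
  rewrite exp_0 in *. lra. }
assert (G0 : g 0 = 0) by (unfold g; ring).
destruct (IVT_gen g 0 4 2 Cg) as [x [Hx Ex]].
{ rewrite G0, Rmin_left, Rmax_right by lra; lra. }
rewrite Rmin_left, Rmax_right in Hx by lra.
assert (Mono : forall y z, 0 < y -> y < z -> g y < g z).
{ intros y z Hy Hz; unfold g.
  assert (0 < tanh (y / 2)).
  { unfold tanh; apply Rdiv_lt_0_compat; [apply sinh_pos; lra | apply cosh_pos]. }
  assert (tanh (y / 2) < tanh (z / 2)) by (apply tanh_lt; lra).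
  apply Rmult_gt_0_lt_compat; lra. }
assert (Px : 0 < x).
{ destruct (proj1 Hx) as [|E]; auto. rewrite <- E, G0 in Ex; lra. }
exists x; split.
- apply Char; auto.
- intros y Py; apply Char in Py; destruct Py as [Hy Ey]. change (g y = 2) in Ey.
  destruct (Rtotal_order x y) as [H|[H|H]]; auto; exfalso.
  + generalize (Mono x y Px H); lra.
  + generalize (Mono y x Hy H); lra.
Qed.

(** * The flat cylinder *)

(** The coefficient [A] of [U] on [psi] solves [A'' = A], so its Wronskians with
    [sinh (t - T / 2)] and [cosh (t - T / 2)] are constant.  Comparing their
    values at the two ends gives [(A T + A 0) * (sinh - sigma * cosh) = 0] and
    [(A T - A 0) * (cosh - sigma * sinh) = 0] at [T / 2]; so [A] vanishes at both
    ends, and both Wronskians are zero. *)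
Lemma mode_vanishes T sigma U (psi dpsi : R -> R) :
  conformal_steklov (fun _ => 1) T sigma U -> 0 < T ->
  (forall h, is_derive psi h (dpsi h)) -> (forall h, is_derive dpsi h (- psi h)) ->
  periodic psi -> periodic dpsi ->
  sinh (T / 2) - sigma * cosh (T / 2) <> 0 -> cosh (T / 2) - sigma * sinh (T / 2) <> 0 ->
  forall t, 0 <= t <= T -> circ (fun h => U t h * psi h) = 0.
Proof.
intros (S & L & B1 & B0) HT Dpsi Ddpsi Ppsi Pdpsi Ntanh Ncoth t.
assert (St := smooth_D_t U S); assert (Stt := smooth_D_t _ St).
assert (Sh := smooth_D_h U S); assert (Shh := smooth_D_h _ Sh).
assert (Kpsi := cts_derive _ _ Dpsi); assert (Kdpsi := cts_derive _ _ Ddpsi).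
assert (D : forall V, smooth_cylinder V -> forall t,
  is_derive (fun t => circ (fun h => V t h * psi h)) t (circ (fun h => D_t V t h * psi h))).
{ intros V SV; assert (KV := smooth_cts V SV); assert (SVt := smooth_D_t V SV).
  apply (is_derive_circ (fun t h => V t h * psi h) (fun t h => D_t V t h * psi h)).
  - intros u h; evar_last.
    apply (is_derive_mult (fun z => V z h) (fun _ => psi h));
     [apply smooth_is_derive_t, SV | apply (is_derive_const (psi h)) | intros; apply Rmult_comm].
    unfold plus, mult, zero; simpl; ring.
  - intros u h; apply continuity_2d_pt_mult; [apply smooth_continuous, SVt|].
    apply continuity_2d_snd, Kpsi.
  - intro u; cont; auto. }
set (A := fun t => circ (fun h => U t h * psi h)).
set (A' := fun t => circ (fun h => D_t U t h * psi h)).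
set (A2 := fun t => circ (fun h => D_t (D_t U) t h * psi h)).
assert (DA : forall t, is_derive A t (A' t)) by (apply D, S).
assert (DA' : forall t, is_derive A' t (A2 t)) by (apply D, St).
assert (EA : forall t, 0 < t < T -> A2 t = A t).
{ intros u Hu; unfold A2, A.
  assert (K := smooth_cts U S u). assert (Kh := smooth_cts _ Sh u).
  assert (Khh := smooth_cts _ Shh u).
  rewrite (circ_ext _ (fun h => (-1) * (psi h * D_h (D_h U) u h)))
    by (intro h; replace (D_t (D_t U) u h) with (- D_h (D_h U) u h) by (specialize (L u h Hu); lra); ring).
  rewrite (circ_scal (-1) (fun h => psi h * D_h (D_h U) u h)) by cont.
  rewrite (circ_by_parts psi (D_h U u) dpsi (D_h (D_h U) u)); auto;
    [ | apply smooth_is_derive_h, Sh | exact (proj1 Sh u) ].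
  rewrite (circ_by_parts dpsi (U u) (fun h => - psi h) (D_h U u)); auto;
    [ | apply smooth_is_derive_h, S | cont | exact (proj1 S u) ].
  rewrite (circ_ext (fun h => - psi h * U u h) (fun h => (-1) * (U u h * psi h))) by (intro; ring).
  rewrite (circ_scal (-1) (fun h => U u h * psi h)) by cont; ring. }
assert (A1T : A' T = sigma * A T).
{ unfold A', A; rewrite (circ_ext _ (fun h => sigma * (U T h * psi h))) by (intro; rewrite B1; ring).
  apply (circ_scal sigma (fun h => U T h * psi h)); assert (K := smooth_cts U S T); cont. }
assert (A10 : A' 0 = - sigma * A 0).
{ unfold A', A; rewrite (circ_ext _ (fun h => (- sigma) * (U 0 h * psi h))) by (intro; rewrite B0; ring).
  apply (circ_scal (- sigma) (fun h => U 0 h * psi h)); assert (K := smooth_cts U S 0); cont. }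
change (0 <= t <= T -> A t = 0).
clearbody A A' A2.
set (W := fun p q (t : R) => A t * p (t - T / 2) - A' t * q (t - T / 2)).
assert (Wc : forall p q : R -> R, (forall x, is_derive p x (q x)) -> (forall x, is_derive q x (p x)) ->
  forall t, 0 <= t <= T -> W p q t = W p q 0).
{ intros p q Dp Dq.
  apply (constant_on T _ (fun t => (A t - A2 t) * q (t - T / 2))); [exact HT | | ].
  - intro u.
    evar_last. apply (is_derive_minus (fun t => A t * p (t - T / 2)) (fun t => A' t * q (t - T / 2))).
    + apply (is_derive_mult A (fun t => p (t - T / 2))); [apply DA | apply (is_derive_shift p q (- (T / 2)) Dp) | intros; apply Rmult_comm].
    + apply (is_derive_mult A' (fun t => q (t - T / 2))); [apply DA' | apply (is_derive_shift q p (- (T / 2)) Dq) | intros; apply Rmult_comm].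
    + unfold Rminus, minus, plus, opp, mult; simpl; ring.
  - intros u Hu; rewrite EA by auto; ring. }
assert (W1 := Wc sinh cosh is_derive_sinh is_derive_cosh).
assert (W2 := Wc cosh sinh is_derive_cosh is_derive_sinh).
clear Wc. unfold W in W1, W2.
replace (0 - T / 2) with (- (T / 2)) in W1, W2 by ring.
rewrite sinh_opp, cosh_opp, A10 in W1, W2.
assert (R1 := W1 T ltac:(lra)). assert (R2 := W2 T ltac:(lra)).
replace (T - T / 2) with (T / 2) in R1, R2 by field.
rewrite A1T in R1, R2.
assert (E1 : (A T + A 0) * (sinh (T / 2) - sigma * cosh (T / 2)) = 0) by lra.
assert (E2 : (A T - A 0) * (cosh (T / 2) - sigma * sinh (T / 2)) = 0) by lra.
apply Rmult_integral in E1; apply Rmult_integral in E2.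
assert (Z : A 0 = 0) by (destruct E1, E2; try lra; tauto).
intro Ht. specialize (W1 t Ht); specialize (W2 t Ht).
rewrite Z in W1, W2. set (x := t - T / 2) in *.
transitivity (A t * (cosh x ^ 2 - sinh x ^ 2)); [rewrite cosh2_sinh2; ring|].
transitivity ((A t * cosh x - A' t * sinh x) * cosh x - (A t * sinh x - A' t * cosh x) * sinh x); [ring|].
rewrite W1, W2; ring.
Qed.

(** If [sigma] is neither [tanh (T / 2)] nor [coth (T / 2)], every slice of [U] minus its
    mean is orthogonal to the low modes, and [refined_wirtinger] provides the
    inequality needed by [eigenvalue_gap]. *)
Lemma flat_eigenvalue_ge T sigma : 0 < T < / 200 -> sigma <> 0 ->
  steklov_eigenvalue product_metric T sigma -> tanh (T / 2) <= sigma.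
Proof.
intros HT Hs E.
destruct (eigenvalue_conformal_steklov (fun _ => 1) product_metric) with (3 := E) as [U [CS NZ]];
  [intro; lra | exact product_conformal |].
assert (Cp := cosh_pos (T / 2)). assert (Sp := sinh_pos (T / 2) ltac:(lra)).
destruct (Req_dec (sinh (T / 2) - sigma * cosh (T / 2)) 0) as [Z|N1].
{ right; unfold tanh. apply Rmult_eq_reg_r with (cosh (T / 2)); [|lra]. field_simplify; lra. }
destruct (Req_dec (cosh (T / 2) - sigma * sinh (T / 2)) 0) as [Z|N2].
{ apply Rle_trans with 1.
  - apply Rle_trans with (T / 2); [apply tanh_le_id|]; lra.
  - apply Rmult_le_reg_r with (sinh (T / 2)); auto.
    assert (sinh (T / 2) < cosh (T / 2)); [|lra].
    unfold sinh, cosh; generalize (exp_pos (- (T / 2))); lra. }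
apply Rlt_le, Rle_lt_trans with (T / 2); [apply tanh_le_id; lra|].
apply (eigenvalue_gap (fun _ => 1) T sigma U); auto.
- apply cts_const.
- intro; reflexivity.
- intro; lra.
- assert (Pms : periodic (fun h => - sin h)) by (intro h; now rewrite periodic_sin).
  assert (Dms : forall h, is_derive (fun h => - sin h) h (- cos h))
    by (intro h; apply (is_derive_opp sin), is_derive_sin).
  assert (S := proj1 CS). intros t Ht.
  assert (Mc := mode_vanishes T sigma U cos _ CS ltac:(lra) is_derive_cos Dms periodic_cos Pms N1 N2 t Ht).
  assert (Ms := mode_vanishes T sigma U sin _ CS ltac:(lra) is_derive_sin is_derive_cos
    periodic_sin periodic_cos N1 N2 t Ht).
  assert (K := smooth_cts U S t). assert (Kh := smooth_cts _ (smooth_D_h U S) t).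
  destruct circ_trig2 as (Ic & Is & _).
  set (c := circ (U t) / (2 * PI)). exists c.
  set (r := fun h => U t h - c).
  assert (Kr : cts r) by (unfold r; cont).
  assert (Or : ortho_low_modes r).
  { unfold r; repeat split.
    - rewrite (circ_ext _ (fun h => U t h + (- c) * 1)) by (intro; ring).
      expand_circ; rewrite circ_const; unfold c; field; generalize PI_RGT_0; lra.
    - rewrite (circ_ext _ (fun h => U t h * cos h + (- c) * cos h)) by (intro; ring).
      expand_circ; rewrite Mc, Ic; ring.
    - rewrite (circ_ext _ (fun h => U t h * sin h + (- c) * sin h)) by (intro; ring).
      expand_circ; rewrite Ms, Is; ring. }
  assert (W : 4 * circ (fun h => r h ^ 2) <= circ (fun h => D_h U t h ^ 2)).
  { apply refined_wirtinger; auto.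
    - intro h; evar_last. apply (is_derive_minus (U t) (fun _ => c));
        [apply smooth_is_derive_h, S | apply (is_derive_const c)].
      unfold minus, plus, opp, zero; simpl; ring.
    - intro h; unfold r; now rewrite (proj1 S t h). }
  rewrite (circ_ext _ (fun h => r h ^ 2)) by (intro; unfold r; ring).
  assert (0 <= circ (fun h => D_h U t h ^ 2)) by (apply circ_ge0; [cont | intro; apply pow2_ge_0]).
  lra.
Qed.

(** Differentiation maps the pair [(psi, dpsi)] to the pair [(dpsi, - psi)], which
    satisfies the same equations; so induct over all pairs. *)
Lemma harmonic_oscillator_smooth n : forall psi dpsi : R -> R,
  (forall x, is_derive psi x (dpsi x)) -> (forall x, is_derive dpsi x (- psi x)) ->
  forall x, ex_derive_n psi n x.
Proof.
induction n as [|n IH]; intros psi dpsi D D' x; [exact I|].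
destruct n as [|n]; [eexists; apply D|].
apply ex_derive_ext with (Derive_n dpsi n).
- intro t. change (Derive_n psi (S n) t) with (Derive_n psi (1 + n) t).
  rewrite Nat.add_comm, <- Derive_n_comp. apply Derive_n_ext; intro u.
  symmetry; apply is_derive_unique, D.
- apply (IH dpsi (fun x => - psi x)); auto.
  intro u; apply (is_derive_opp psi), D.
Qed.

Lemma is_derive_mult_const (f : R -> R) x l k :
  is_derive f x l -> is_derive (fun z => f z * k) x (l * k).
Proof. exact (is_derive_scal_l f x l k). Qed.

(** The same induction: each partial derivative of [phi * psi] is again a product of
    this kind. *)
Lemma separated_smooth n : forall phi dphi psi dpsi : R -> R,
  (forall x, is_derive phi x (dphi x)) -> (forall x, is_derive dphi x (phi x)) ->
  (forall x, is_derive psi x (dpsi x)) -> (forall x, is_derive dpsi x (- psi x)) ->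
  forall t h, ex_diff_n (fun t h => phi t * psi h) n t h.
Proof.
induction n as [|n IH]; intros phi dphi psi dpsi P P' Q Q' t h.
all: assert (C : continuity_2d_pt (fun t h => phi t * psi h) t h) by (
  apply continuity_2d_pt_mult;
  [ apply (continuity_1d_2d_pt_comp phi (fun t _ => t)); [exact (derive_cont _ _ _ (P t)) | apply continuity_2d_pt_id1]
  | apply (continuity_1d_2d_pt_comp psi (fun _ h => h)); [exact (derive_cont _ _ _ (Q h)) | apply continuity_2d_pt_id2] ]).
{ split; auto. }
assert (Dt : forall u v, is_derive (fun z => phi z * psi v) u (dphi u * psi v)).
{ intros u v; apply is_derive_mult_const, P. }
assert (Dh : forall u v, is_derive (fun z => phi u * psi z) v (phi u * dpsi v)).
{ intros u v; apply (is_derive_scal psi), Q. }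
split; [exact C|]. split; [eexists; apply Dt|]. split; [eexists; apply Dh|]. split.
- apply ex_diff_n_ext_loc with (fun u v => dphi u * psi v).
  + exists (mkposreal 1 Rlt_0_1); intros; symmetry; apply is_derive_unique, Dt.
  + apply (IH dphi phi psi dpsi); auto.
- apply ex_diff_n_ext_loc with (fun u v => phi u * dpsi v).
  + exists (mkposreal 1 Rlt_0_1); intros; symmetry; apply is_derive_unique, Dh.
  + apply (IH phi dphi dpsi (fun x => - psi x)); auto. intro x; apply (is_derive_opp psi), Q.
Qed.

Lemma flat_eigenvalue_tanh T : steklov_eigenvalue product_metric T (tanh (T / 2)).
Proof.
set (phi := fun t => cosh (t - T / 2)). set (dphi := fun t => sinh (t - T / 2)).
assert (P : forall x, is_derive phi x (dphi x)) by exact (is_derive_shift cosh sinh (- (T / 2)) is_derive_cosh).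
assert (P' : forall x, is_derive dphi x (phi x)) by exact (is_derive_shift sinh cosh (- (T / 2)) is_derive_sinh).
assert (Q := is_derive_cos).
assert (Q' : forall h, is_derive (fun h => - sin h) h (- cos h))
  by (intro h; apply (is_derive_opp sin), is_derive_sin).
set (U := fun t h => phi t * cos h).
assert (Ut : forall t h, D_t U t h = dphi t * cos h).
{ intros t h; apply is_derive_unique. apply is_derive_mult_const, P. }
assert (Utt : forall t h, D_t (D_t U) t h = phi t * cos h).
{ intros t h; unfold D_t at 1; rewrite (Derive_ext _ (fun z => dphi z * cos h)) by (intro; apply Ut).
  apply is_derive_unique. apply is_derive_mult_const, P'. }
assert (Uh : forall t h, D_h U t h = phi t * - sin h).
{ intros t h; apply is_derive_unique, (is_derive_scal cos), Q. }
assert (Uhh : forall t h, D_h (D_h U) t h = phi t * - cos h).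
{ intros t h; unfold D_h at 1; rewrite (Derive_ext _ (fun z => phi t * - sin z)) by (intro; apply Uh).
  apply is_derive_unique, (is_derive_scal (fun h => - sin h)), Q'. }
assert (Pos : forall h : R, 0 < (fun _ => 1) h) by (intro; lra).
exists (fun i h => U (bd_t T i) h). split; [|split].
- exists true, 0. unfold U; rewrite cos_0, Rmult_1_r. apply Rgt_not_eq, cosh_pos.
- split.
  + intros i h; unfold U; now rewrite periodic_cos.
  + intros i n h; apply ex_derive_n_scal_l, (harmonic_oscillator_smooth n cos (fun h => - sin h)); auto.
- exists U; split; [split; [split|split] |].
  + intros t h; unfold U; now rewrite periodic_cos.
  + intros n; apply (separated_smooth n phi dphi cos (fun h => - sin h)); auto.
  + intros t h _; rewrite (conformal_laplace (fun _ => 1)) by (auto; exact product_conformal).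
    rewrite Utt, Uhh; field.
  + reflexivity.
  + intros i h; rewrite (conformal_normal (fun _ => 1)) by (auto; exact product_conformal).
    assert (C := cosh_pos (T / 2)).
    rewrite Ut; unfold U, phi, dphi, tanh; destruct i; simpl.
    * replace (T - T / 2) with (T / 2) by field; field; lra.
    * replace (0 - T / 2) with (- (T / 2)) by field; rewrite sinh_opp, cosh_opp; field; lra.
Qed.

Theorem theorem5p1 :
  exists Tstar : R, 0 < Tstar <= T_10 /\
    forall T : R, 0 < T < Tstar ->
      (forall sigma1 : R,
         first_nonzero_steklov (warped_metric f_warp) T sigma1 ->
         sigma1 > tanh (T / 2)) /\
      first_nonzero_steklov product_metric T (tanh (T / 2)).
Proof.
exists (Rmin (/ 200) T_10). split.
{ split; [apply Rmin_glb_lt; [lra | apply T_10_pos] | apply Rmin_r]. }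
intros T [T0 T1].
assert (HT : 0 < T < / 200) by (split; [exact T0 | eapply Rlt_le_trans; [exact T1 | apply Rmin_l]]).
assert (Th := tanh_le_id (T / 2) ltac:(lra)).
split.
- intros sigma (E & Ns & _).
  destruct (eigenvalue_conformal_steklov f_warp (warped_metric f_warp)) with (3 := E) as [U [CS NZ]];
    [intro; apply f_warp_bounds | apply warped_conformal |].
  assert (S := proj1 CS).
  apply Rle_lt_trans with (T / 2); auto.
  apply (eigenvalue_gap f_warp T sigma U); auto.
  + exact cts_f_warp.
  + intro h; now rewrite !f_warp_poly, periodic_cos.
  + exact f_warp_bounds.
  + intros t _; apply weighted_poincare.
    * apply smooth_is_derive_h, S.
    * apply smooth_cts, smooth_D_h, S.
    * exact (proj1 S t).
- split; [apply flat_eigenvalue_tanh|]. split.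
  + assert (0 < tanh (T / 2)); [|lra].
    unfold tanh; apply Rdiv_lt_0_compat; [apply sinh_pos; lra | apply cosh_pos].
  + intros s E Ns; apply flat_eigenvalue_ge; auto.
Qed.
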